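(* Over $\mathsf{RCA}_0$, the following are equivalent: (1) $\mathsf{ACA}_0$. (2) Every e-matroid is isomorphic to a matroid; that is, if $(M,e)$ is an e-matroid, then there is a matroid $(N,D)$ and a bijection $h\colon M\to N$ such that for all finite $X\subseteq M$, there is an $n$ with $e(n)=X$ if and only if $\{h(x):x\in X\}\in D$.
   Context: Work in second-order arithmetic. An e-matroid is a pair $(M,e)$ with $M\subseteq\mathbb{N}$ and $e\colon\mathbb{N}\to M^{<\mathbb{N}}$ (finite subsets of $M$) such that: (i) $e(n)\neq\emptyset$ for all $n$; (ii) for all $n$ and finite $Y\subseteq M$, if $e(n)\subseteq Y$ then $Y=e(m)$ for some $m$; (iii) for all finite $X,Y\subseteq M$ with $|X|<|Y|$ and $X,Y$ not in the range of $e$, some $y\in Y$ has $X\cup\{y\}$ not in the range of $e$. A matroid is a pair $(N,D)$ with $N\subseteq\mathbb{N}$ and $D$ a set of codes of finite subsets of $N$ such that: $\emptyset\notin D$; finite supersets (within $N$) of members of $D$ are in $D$; and for finite $X,Y\subseteq N$ with $|X|<|Y|$ and $X,Y\notin D$, some $y\in Y$ has $X\cup\{y\}\notin D$. *)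

(* Defs.v *)
From Stdlib Require Import Arith.

Set Implicit Arguments.

(** * The language of second-order arithmetic

    Two sorts of de Bruijn indices: [Var n] is a number variable, and a bare
    [nat] in [Mem], bound by [AllS], is a set variable.  The two index spaces
    are independent. *)

Inductive term : Type :=
| Var (n : nat)
| Zero
| One
| Add (t u : term)
| Mul (t u : term).

Inductive form : Type :=
| Eq (t u : term)
| Lt (t u : term)
| Mem (t : term) (X : nat)
| Bot
| Imp (p q : form)
| AllN (p : form)
| AllS (p : form).

(** The logic is classical, so the other connectives are abbreviations. *)
Definition Neg (p : form) : form := Imp p Bot.
Definition And (p q : form) : form := Neg (Imp p (Neg q)).
Definition Or (p q : form) : form := Imp (Neg p) q.
Definition Iff (p q : form) : form := And (Imp p q) (Imp q p).
Definition ExN (p : form) : form := Neg (AllN (Neg p)).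
Definition ExS (p : form) : form := Neg (AllS (Neg p)).

Definition scons {A : Type} (a : A) (f : nat -> A) (n : nat) : A :=
  match n with 0 => a | S m => f m end.

Fixpoint subst_term (sg : nat -> term) (t : term) : term :=
  match t with
  | Var n => sg n
  | Zero => Zero
  | One => One
  | Add t u => Add (subst_term sg t) (subst_term sg u)
  | Mul t u => Mul (subst_term sg t) (subst_term sg u)
  end.

Definition shift_term : term -> term := subst_term (fun n => Var (S n)).

Definition upN (sg : nat -> term) : nat -> term :=
  scons (Var 0) (fun n => shift_term (sg n)).

Definition upS (xi : nat -> nat) : nat -> nat :=
  scons 0 (fun X => S (xi X)).

(** Capture-avoiding simultaneous substitution of terms for number variables
    and of set variables for set variables. *)
Fixpoint subst (sg : nat -> term) (xi : nat -> nat) (p : form) : form :=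
  match p with
  | Eq t u => Eq (subst_term sg t) (subst_term sg u)
  | Lt t u => Lt (subst_term sg t) (subst_term sg u)
  | Mem t X => Mem (subst_term sg t) (xi X)
  | Bot => Bot
  | Imp p q => Imp (subst sg xi p) (subst sg xi q)
  | AllN p => AllN (subst (upN sg) xi p)
  | AllS p => AllS (subst sg (upS xi) p)
  end.

Definition shiftN (p : form) : form := subst (fun n => Var (S n)) (fun X => X) p.
Definition shiftS (p : form) : form := subst Var S p.
Definition instN (t : term) (p : form) : form := subst (scons t Var) (fun X => X) p.
Definition instS (Y : nat) (p : form) : form := subst Var (scons Y (fun X => X)) p.

(** * Provability

    A Hilbert calculus for two-sorted classical logic with equality between
    numbers.  Generalization is unrestricted, so a formula of [T] with free
    variables acts as its universal closure. *)

Definition theory : Type := form -> Prop.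

Inductive provable (T : theory) : form -> Prop :=
| pr_ax p : T p -> provable T p
| pr_mp p q : provable T (Imp p q) -> provable T p -> provable T q
| pr_genN p : provable T p -> provable T (AllN p)
| pr_genS p : provable T p -> provable T (AllS p)
| pr_K p q : provable T (Imp p (Imp q p))
| pr_S p q r :
    provable T (Imp (Imp p (Imp q r)) (Imp (Imp p q) (Imp p r)))
| pr_dn p : provable T (Imp (Neg (Neg p)) p)
| pr_instN p t : provable T (Imp (AllN p) (instN t p))
| pr_instS p Y : provable T (Imp (AllS p) (instS Y p))
| pr_distN p q : provable T (Imp (AllN (Imp p q)) (Imp (AllN p) (AllN q)))
| pr_distS p q : provable T (Imp (AllS (Imp p q)) (Imp (AllS p) (AllS q)))
| pr_vacN p : provable T (Imp p (AllN (shiftN p)))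
| pr_vacS p : provable T (Imp p (AllS (shiftS p)))
| pr_refl t : provable T (Eq t t)
| pr_leibniz p t u :
    provable T (Imp (Eq t u) (Imp (instN t p) (instN u p))).

Definition union_theory (T U : theory) : theory := fun p => T p \/ U p.

(** Over the base theory [B], each of [T] and [U] proves all of the other. *)
Definition equivalent_over (B T U : theory) : Prop :=
  (forall p, U p -> provable (union_theory B T) p) /\
  (forall p, T p -> provable (union_theory B U) p).

(** * The systems RCA_0 and ACA_0 *)

Inductive basic_axiom : theory :=
| ba_succ_ne0 : basic_axiom (Neg (Eq (Add (Var 0) One) Zero))
| ba_succ_inj :
    basic_axiom (Imp (Eq (Add (Var 0) One) (Add (Var 1) One))
                     (Eq (Var 0) (Var 1)))
| ba_add0 : basic_axiom (Eq (Add (Var 0) Zero) (Var 0))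
| ba_addS :
    basic_axiom (Eq (Add (Var 0) (Add (Var 1) One))
                    (Add (Add (Var 0) (Var 1)) One))
| ba_mul0 : basic_axiom (Eq (Mul (Var 0) Zero) Zero)
| ba_mulS :
    basic_axiom (Eq (Mul (Var 0) (Add (Var 1) One))
                    (Add (Mul (Var 0) (Var 1)) (Var 0)))
| ba_lt0 : basic_axiom (Neg (Lt (Var 0) Zero))
| ba_ltS :
    basic_axiom (Iff (Lt (Var 0) (Add (Var 1) One))
                     (Or (Lt (Var 0) (Var 1)) (Eq (Var 0) (Var 1)))).

(** Formulas with bounded number quantifiers only.  The bound is shifted, so
    that it does not contain the bound variable.  Bounded existential
    quantifiers, and the other connectives, arise through [Imp] and [Bot]. *)
Inductive bounded_form : form -> Prop :=
| bf_eq t u : bounded_form (Eq t u)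
| bf_lt t u : bounded_form (Lt t u)
| bf_mem t X : bounded_form (Mem t X)
| bf_bot : bounded_form Bot
| bf_imp p q : bounded_form p -> bounded_form q -> bounded_form (Imp p q)
| bf_all t p :
    bounded_form p ->
    bounded_form (AllN (Imp (Lt (Var 0) (shift_term t)) p)).

Definition Sigma01 (p : form) : Prop := exists q, bounded_form q /\ p = ExN q.
Definition Pi01 (p : form) : Prop := exists q, bounded_form q /\ p = AllN q.

Fixpoint arithmetical (p : form) : Prop :=
  match p with
  | Eq _ _ | Lt _ _ | Mem _ _ | Bot => True
  | Imp p q => arithmetical p /\ arithmetical q
  | AllN p => arithmetical p
  | AllS _ => False
  end.

(** In both schemes [Var 0] is the distinguished variable of [p], and all other
    free variables of [p] are parameters. *)
Definition induction_for (p : form) : form :=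
  Imp (And (instN Zero p)
           (AllN (Imp p (subst (scons (Add (Var 0) One) (fun n => Var (S n)))
                               (fun X => X) p))))
      (AllN p).

Definition comprehension_for (p : form) : form :=
  ExS (AllN (Iff (Mem (Var 0) 0) (shiftS p))).

Inductive RCA0 : theory :=
| rca_basic p : basic_axiom p -> RCA0 p
| rca_induction p : Sigma01 p -> RCA0 (induction_for p)
| rca_comprehension p q :
    Sigma01 p -> Pi01 q ->
    RCA0 (Imp (AllN (Iff p q)) (comprehension_for p)).

Inductive ACA0 : theory :=
| aca_basic p : basic_axiom p -> ACA0 p
| aca_induction : ACA0 (induction_for (Mem (Var 0) 0))
| aca_comprehension p : arithmetical p -> ACA0 (comprehension_for p).

(** * Writing formulas with named variables

    [fm], [tm] and [sv] are formulas, terms and set variables as functions of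
    the number of enclosing number and set quantifiers.  A variable bound under
    [d] quantifiers has index [d' - S d] when it is used under [d']. *)

Definition tm : Type := nat -> term.
Definition sv : Type := nat -> nat.
Definition fm : Type := nat -> nat -> form.

Definition zero : tm := fun _ => Zero.
Definition one : tm := fun _ => One.
Definition add (x y : tm) : tm := fun d => Add (x d) (y d).
Definition mul (x y : tm) : tm := fun d => Mul (x d) (y d).
Definition eq_ (x y : tm) : fm := fun d _ => Eq (x d) (y d).
Definition lt_ (x y : tm) : fm := fun d _ => Lt (x d) (y d).
Definition mem_ (x : tm) (X : sv) : fm := fun d s => Mem (x d) (X s).
Definition neg_ (p : fm) : fm := fun d s => Neg (p d s).
Definition imp_ (p q : fm) : fm := fun d s => Imp (p d s) (q d s).
Definition and_ (p q : fm) : fm := fun d s => And (p d s) (q d s).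
Definition or_ (p q : fm) : fm := fun d s => Or (p d s) (q d s).
Definition iff_ (p q : fm) : fm := fun d s => Iff (p d s) (q d s).
Definition all_ (p : tm -> fm) : fm :=
  fun d s => AllN (p (fun d' => Var (d' - S d)) (S d) s).
Definition ex_ (p : tm -> fm) : fm :=
  fun d s => ExN (p (fun d' => Var (d' - S d)) (S d) s).
Definition allS_ (p : sv -> fm) : fm :=
  fun d s => AllS (p (fun s' => s' - S s) d (S s)).
Definition exS_ (p : sv -> fm) : fm :=
  fun d s => ExS (p (fun s' => s' - S s) d (S s)).

Declare Scope so_scope.
Delimit Scope so_scope with so.
Bind Scope so_scope with fm.

Infix "⊕" := add (at level 50, left associativity) : so_scope.
Infix "⊗" := mul (at level 40, left associativity) : so_scope.
Infix "≐" := eq_ (at level 70, no associativity) : so_scope.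
Infix "≺" := lt_ (at level 70, no associativity) : so_scope.
Infix "∊" := mem_ (at level 70, no associativity) : so_scope.
Notation "¬ p" := (neg_ p) (at level 75, right associativity) : so_scope.
Infix "∧" := and_ (at level 80, right associativity) : so_scope.
Infix "∨" := or_ (at level 85, right associativity) : so_scope.
Infix "⇒" := imp_ (at level 90, right associativity) : so_scope.
Infix "⇔" := iff_ (at level 95, no associativity) : so_scope.
Notation "∀ x .. y , p" := (all_ (fun x => .. (all_ (fun y => p%so)) ..))
  (at level 200, x binder, y binder, right associativity) : so_scope.
Notation "∃ x .. y , p" := (ex_ (fun x => .. (ex_ (fun y => p%so)) ..))
  (at level 200, x binder, y binder, right associativity) : so_scope.
Notation "∀² X .. Y , p" := (allS_ (fun X => .. (allS_ (fun Y => p%so)) ..))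
  (at level 200, X binder, Y binder, right associativity) : so_scope.
Notation "∃² X .. Y , p" := (exS_ (fun X => .. (exS_ (fun Y => p%so)) ..))
  (at level 200, X binder, Y binder, right associativity) : so_scope.

Local Open Scope so_scope.

(** * Pairs, functions and finite sets in second-order arithmetic *)

(** (i, j) = (i + j)^2 + i *)
Definition pair (i j : tm) : tm := ((i ⊕ j) ⊗ (i ⊕ j) ⊕ i)%so.

(** A finite set is coded, following Simpson, by a triple (k, (m, n)) that
    stands for {i < k : m(i + 1) + 1 divides n}. *)
Definition in_triple (i k m n : tm) : fm :=
  i ≺ k ∧ ∃ q, n ≐ q ⊗ (m ⊗ (i ⊕ one) ⊕ one).

Definition is_triple (z : tm) : fm := ∃ k m n, z ≐ pair k (pair m n).

Definition in_fin (i z : tm) : fm :=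
  ∃ k m n, z ≐ pair k (pair m n) ∧ in_triple i k m n.

(** The code of a finite set is the least triple that stands for it, so a
    finite set has exactly one code. *)
Definition is_code (z : tm) : fm :=
  is_triple z ∧
  ∀ w, w ≺ z ∧ is_triple w ⇒ ¬ (∀ i, in_fin i w ⇔ in_fin i z).

Definition fin_subset_of (A : sv) (c : tm) : fm :=
  is_code c ∧ ∀ i, in_fin i c ⇒ i ∊ A.

Definition fin_sub (a b : tm) : fm := ∀ i, in_fin i a ⇒ in_fin i b.

(** Graph of a function: [F], [A] and [B] are given by their membership
    conditions, so that both sets and codes of finite sets can be used. *)
Definition is_function (F A B : tm -> fm) : fm :=
  (∀ p, F p ⇒ ∃ x y, A x ∧ B y ∧ p ≐ pair x y) ∧
  (∀ x, A x ⇒ ∃ y, F (pair x y)) ∧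
  (∀ x y z, F (pair x y) ∧ F (pair x z) ⇒ y ≐ z).

Definition is_bijection (F A B : tm -> fm) : fm :=
  is_function F A B ∧
  (∀ x y z, F (pair x z) ∧ F (pair y z) ⇒ x ≐ y) ∧
  (∀ y, B y ⇒ ∃ x, F (pair x y)).

(** |c| = k *)
Definition card_is (c k : tm) : fm :=
  ∃ f, is_code f ∧
       is_bijection (fun p => in_fin p f) (fun i => i ≺ k) (fun x => in_fin x c).

Definition card_lt (a b : tm) : fm :=
  ∃ k l, card_is a k ∧ card_is b l ∧ k ≺ l.

(** * Matroids and e-matroids *)

(** [dep c] says that the finite set with code [c] is dependent. *)
Definition exchange (G : sv) (dep : tm -> fm) : fm :=
  ∀ a b,
    fin_subset_of G a ∧ fin_subset_of G b ∧ card_lt a b ∧ ¬ dep a ∧ ¬ dep b ⇒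
    ∃ y, in_fin y b ∧
         ¬ (∃ c, is_code c ∧ (∀ i, in_fin i c ⇔ in_fin i a ∨ i ≐ y) ∧ dep c).

Definition in_range (e : sv) (c : tm) : fm := ∃ n, pair n c ∊ e.

Definition is_ematroid (M e : sv) : fm :=
  is_function (fun p => p ∊ e) (fun n => n ≐ n) (fun c => fin_subset_of M c) ∧
  (∀ n c, pair n c ∊ e ⇒ ∃ i, in_fin i c) ∧
  (∀ n c b, pair n c ∊ e ∧ fin_subset_of M b ∧ fin_sub c b ⇒ in_range e b) ∧
  exchange M (in_range e).

Definition is_matroid (N D : sv) : fm :=
  (∀ c, c ∊ D ⇒ fin_subset_of N c) ∧
  (∀ c, c ∊ D ⇒ ∃ i, in_fin i c) ∧
  (∀ c b, c ∊ D ∧ fin_subset_of N b ∧ fin_sub c b ⇒ b ∊ D) ∧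
  exchange N (fun c => c ∊ D).

Definition is_isomorphism (M e N D h : sv) : fm :=
  is_bijection (fun p => p ∊ h) (fun x => x ∊ M) (fun y => y ∊ N) ∧
  (∀ a, fin_subset_of M a ⇒
    (in_range e a ⇔
     ∃ c, is_code c ∧
          (∀ y, in_fin y c ⇔ ∃ x, in_fin x a ∧ pair x y ∊ h) ∧
          c ∊ D)).

Definition every_ematroid_isomorphic_to_matroid : fm :=
  ∀² M e, is_ematroid M e ⇒
    ∃² N D h, is_matroid N D ∧ is_isomorphism M e N D h.

(** A formula with no free variables, as a sentence. *)
Definition sentence (p : fm) : form := p 0 0.

(* Main.v *)
From Stdlib Require Import Arith Lia List Cantor Ring.
From Stdlib Require Import Classical ClassicalEpsilon FunctionalExtensionality
  PropExtensionality.
Require Import Defs.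

(** By Henkin completeness it suffices to argue in an arbitrary model.

    If arithmetical comprehension holds, the range of the enumeration [e] of an
    e-matroid is a set [D], and the identity is an isomorphism onto the matroid
    [(M, D)].

    Conversely, given a set [Y], let [R = {w | exists x, (x, w) in Y}] and consider
    the e-matroid on all numbers whose dependent sets are the finite sets that
    meet [R]: the elements of [R] are loops, the other elements are free, and
    exchange holds because a union of independent sets is independent.  If [h] is
    an isomorphism onto a matroid with set [D] of dependent sets, then [w] is in
    [R] iff the code of [{h(w)}] is in [D].  So [R] is Delta^0_1 in [Y], [h] and
    [D], and exists.  Iterating this along the quantifiers of a formula yields
    arithmetical comprehension. *)

Set Implicit Arguments.

(** * Substitution *)

(** The reversal exploits an asymmetry: an e-matroid only enumerates its dependent sets, while a
    matroid decides them through [D]. The dependent sets built from Y are merely Sigma^0_1, yet [e]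
    can list them in stages as soon as one default dependent set is available. After the
    isomorphism, the complement of R becomes Sigma^0_1 as well: w is outside R iff there are y and a
    code c of {y} with (w, y) in [h] and c not in [D]. A model may contain nonstandard numbers, and
    only Sigma^0_1 induction and Delta^0_1 comprehension are available in it. Definability is
    therefore handled as a closure property of predicates on environments, and the bounds on
    quantifiers come from the growth of the pairing function. To iterate over quantifiers, the
    values of the first d variables are packed into one number. Entering a quantifier lengthens the
    tuple by one, and projection shortens it again, so the induction on formulas must treat all
    lengths d at once. *)

Lemma subst_term_comp sg tau t :
  subst_term tau (subst_term sg t) = subst_term (fun n => subst_term tau (sg n)) t.
Proof. induction t; simpl; congruence. Qed.

Lemma subst_term_Var t : subst_term Var t = t.
Proof. induction t; simpl; congruence. Qed.

Lemma subst_shift_term sg t :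
  subst_term (upN sg) (shift_term t) = shift_term (subst_term sg t).
Proof. unfold shift_term. now rewrite !subst_term_comp. Qed.

Lemma inst_shift_term u sg t :
  subst_term (scons u sg) (shift_term t) = subst_term sg t.
Proof. unfold shift_term. now rewrite subst_term_comp. Qed.

Lemma upN_comp sg tau :
  (fun n => subst_term (upN tau) (upN sg n)) = upN (fun n => subst_term tau (sg n)).
Proof.
  apply functional_extensionality; intros [|n]; simpl; [easy|].
  apply subst_shift_term.
Qed.

Lemma upS_comp xi zeta : (fun n => upS zeta (upS xi n)) = upS (fun n => zeta (xi n)).
Proof. now apply functional_extensionality; intros [|n]. Qed.

Lemma upN_Var : upN Var = Var.
Proof. now apply functional_extensionality; intros [|n]. Qed.

Lemma upS_id : upS (fun X => X) = fun X => X.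
Proof. now apply functional_extensionality; intros [|n]. Qed.

Lemma subst_comp p : forall sg xi tau zeta,
  subst tau zeta (subst sg xi p)
  = subst (fun n => subst_term tau (sg n)) (fun n => zeta (xi n)) p.
Proof.
  induction p; intros; simpl; rewrite ?subst_term_comp; trivial.
  - now rewrite IHp1, IHp2.
  - now rewrite IHp, upN_comp.
  - now rewrite IHp, upS_comp.
Qed.

Lemma subst_id p : subst Var (fun X => X) p = p.
Proof.
  induction p; simpl; rewrite ?subst_term_Var, ?upN_Var, ?upS_id; congruence.
Qed.

Lemma instN_upN t sg xi p :
  instN t (subst (upN sg) xi p) = subst (scons t sg) xi p.
Proof.
  unfold instN. rewrite subst_comp. f_equal.
  apply functional_extensionality; intros [|n]; simpl; [easy|].
  now rewrite inst_shift_term, subst_term_Var.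
Qed.

Lemma instS_upS Y sg xi p :
  instS Y (subst sg (upS xi) p) = subst sg (scons Y xi) p.
Proof.
  unfold instS. rewrite subst_comp. f_equal.
  - apply functional_extensionality; intros n. apply subst_term_Var.
  - now apply functional_extensionality; intros [|n].
Qed.

Fixpoint closed_term (k : nat) (t : term) : Prop :=
  match t with
  | Var n => n < k
  | Zero | One => True
  | Add t u | Mul t u => closed_term k t /\ closed_term k u
  end.

Fixpoint closed_form (k s : nat) (p : form) : Prop :=
  match p with
  | Eq t u | Lt t u => closed_term k t /\ closed_term k u
  | Mem t X => closed_term k t /\ X < s
  | Bot => True
  | Imp p q => closed_form k s p /\ closed_form k s q
  | AllN p => closed_form (S k) s p
  | AllS p => closed_form k (S s) p
  end.

Lemma subst_term_closed k t sg tau :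
  closed_term k t -> (forall n, n < k -> sg n = tau n) ->
  subst_term sg t = subst_term tau t.
Proof. intros Ht E; induction t; simpl in *; f_equal; auto; tauto. Qed.

Lemma subst_closed p : forall k s sg tau xi zeta,
  closed_form k s p ->
  (forall n, n < k -> sg n = tau n) -> (forall n, n < s -> xi n = zeta n) ->
  subst sg xi p = subst tau zeta p.
Proof.
  induction p; simpl; intros k s sg tau xi zeta Hp E F; try easy;
    try (f_equal; try apply F; try (apply subst_term_closed with k); tauto).
  - f_equal; [eapply IHp1 | eapply IHp2]; eauto; tauto.
  - f_equal. apply IHp with (S k) s; trivial.
    intros [|n] Hn; simpl; trivial. rewrite E; trivial; lia.
  - f_equal. apply IHp with k (S s); trivial.
    intros [|n] Hn; simpl; trivial. rewrite F; trivial; lia.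
Qed.

Fixpoint bound_term (t : term) : nat :=
  match t with
  | Var n => S n
  | Zero | One => 0
  | Add t u | Mul t u => max (bound_term t) (bound_term u)
  end.

(** One bound serves both sorts, and quantifiers do not lower it: an index at or above it is fresh
    both as a number variable and as a set variable. *)
Fixpoint bound_form (p : form) : nat :=
  match p with
  | Eq t u | Lt t u => max (bound_term t) (bound_term u)
  | Mem t X => max (bound_term t) (S X)
  | Bot => 0
  | Imp p q => max (bound_form p) (bound_form q)
  | AllN p | AllS p => bound_form p
  end.

Lemma closed_term_bound t k : bound_term t <= k -> closed_term k t.
Proof. induction t; simpl; intros; trivial; split; (apply IHt1 || apply IHt2); lia. Qed.

Lemma closed_form_bound p : forall k s,
  bound_form p <= k -> bound_form p <= s -> closed_form k s p.
Proof.
  induction p; simpl; intros; trivial;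
    try (split; try apply closed_term_bound; try lia);
    try (apply IHp1 || apply IHp2 || apply IHp); lia.
Qed.

(** * Enumeration of formulas *)

Fixpoint decode_term (d n : nat) : term :=
  match d with
  | 0 => Zero
  | S d =>
    let (k, m) := Cantor.of_nat n in
    let (a, b) := Cantor.of_nat m in
    match k with
    | 0 => Var m
    | 1 => One
    | 2 => Add (decode_term d a) (decode_term d b)
    | 3 => Mul (decode_term d a) (decode_term d b)
    | _ => Zero
    end
  end.

Fixpoint decode_form (d n : nat) : form :=
  match d with
  | 0 => Bot
  | S d =>
    let (k, m) := Cantor.of_nat n in
    let (a, b) := Cantor.of_nat m in
    match k with
    | 0 => Eq (decode_term d a) (decode_term d b)
    | 1 => Lt (decode_term d a) (decode_term d b)
    | 2 => Mem (decode_term d a) b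
    | 3 => Imp (decode_form d a) (decode_form d b)
    | 4 => AllN (decode_form d m)
    | 5 => AllS (decode_form d m)
    | _ => Bot
    end
  end.

Ltac decode_with k m :=
  exists (Cantor.to_nat (k, m)); cbn [decode_term decode_form];
  rewrite ?Cantor.cancel_of_to.

Ltac need_succ d := destruct d as [|d]; [lia|].

(** All large depths are covered, because the two parts of a compound term are decoded at one common
    depth. *)
Lemma decode_term_surj t : exists D, forall d, D <= d -> exists n, decode_term d n = t.
Proof.
  induction t as [n| | |t [D Ht] u [E Hu]|t [D Ht] u [E Hu]].
  - exists 1; intros d Hd; need_succ d. decode_with 0 n. now destruct (of_nat n).
  (* Tag 4 falls into the default branch, which is [Zero]. *)
  - exists 1; intros d Hd; need_succ d. now decode_with 4 (Cantor.to_nat (0, 0)).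
  - exists 1; intros d Hd; need_succ d. now decode_with 1 (Cantor.to_nat (0, 0)).
  - exists (S (max D E)); intros d Hd; need_succ d.
    destruct (Ht d) as [a <-]; [lia|]. destruct (Hu d) as [b <-]; [lia|].
    now decode_with 2 (Cantor.to_nat (a, b)).
  - exists (S (max D E)); intros d Hd; need_succ d.
    destruct (Ht d) as [a <-]; [lia|]. destruct (Hu d) as [b <-]; [lia|].
    now decode_with 3 (Cantor.to_nat (a, b)).
Qed.

Lemma decode_form_surj p : exists D, forall d, D <= d -> exists n, decode_form d n = p.
Proof.
  induction p as [t u|t u|t X| |p [D Hp] q [E Hq]|p [D Hp]|p [D Hp]].
  - destruct (decode_term_surj t) as [D Ht], (decode_term_surj u) as [E Hu].
    exists (S (max D E)); intros d Hd; need_succ d.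
    destruct (Ht d) as [a <-]; [lia|]. destruct (Hu d) as [b <-]; [lia|].
    now decode_with 0 (Cantor.to_nat (a, b)).
  - destruct (decode_term_surj t) as [D Ht], (decode_term_surj u) as [E Hu].
    exists (S (max D E)); intros d Hd; need_succ d.
    destruct (Ht d) as [a <-]; [lia|]. destruct (Hu d) as [b <-]; [lia|].
    now decode_with 1 (Cantor.to_nat (a, b)).
  - destruct (decode_term_surj t) as [D Ht].
    exists (S D); intros d Hd; need_succ d.
    destruct (Ht d) as [a <-]; [lia|].
    now decode_with 2 (Cantor.to_nat (a, X)).
  - exists 0; intros d Hd; destruct d; [now exists 0|].
    now decode_with 6 (Cantor.to_nat (0, 0)).
  - exists (S (max D E)); intros d Hd; need_succ d.
    destruct (Hp d) as [a <-]; [lia|]. destruct (Hq d) as [b <-]; [lia|].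
    now decode_with 3 (Cantor.to_nat (a, b)).
  - exists (S D); intros d Hd; need_succ d.
    destruct (Hp d) as [a <-]; [lia|]. decode_with 4 a. now destruct (of_nat a).
  - exists (S D); intros d Hd; need_succ d.
    destruct (Hp d) as [a <-]; [lia|]. decode_with 5 a. now destruct (of_nat a).
Qed.

Definition enum_form (n : nat) : form :=
  let (d, m) := Cantor.of_nat n in decode_form d m.

Lemma enum_form_surj p : exists n, enum_form n = p.
Proof.
  destruct (decode_form_surj p) as [D Hp]. destruct (Hp D) as [n <-]; trivial.
  exists (Cantor.to_nat (D, n)). unfold enum_form. now rewrite Cantor.cancel_of_to.
Qed.

(** * Models *)

Record model : Type := {
  num : Type;
  st : Type;
  m0 : num;
  m1 : num;
  madd : num -> num -> num;
  mmul : num -> num -> num;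
  mlt : num -> num -> Prop;
  mem : num -> st -> Prop }.

Fixpoint eval (M : model) (rho : nat -> num M) (t : term) : num M :=
  match t with
  | Var n => rho n
  | Zero => m0 M
  | One => m1 M
  | Add t u => madd M (eval M rho t) (eval M rho u)
  | Mul t u => mmul M (eval M rho t) (eval M rho u)
  end.

Fixpoint sat (M : model) (rho : nat -> num M) (eta : nat -> st M) (p : form) : Prop :=
  match p with
  | Eq t u => eval M rho t = eval M rho u
  | Lt t u => mlt M (eval M rho t) (eval M rho u)
  | Mem t X => mem M (eval M rho t) (eta X)
  | Bot => False
  | Imp p q => sat M rho eta p -> sat M rho eta q
  | AllN p => forall a, sat M (scons a rho) eta p
  | AllS p => forall A, sat M rho (scons A eta) p
  end.

Definition models (M : model) (T : theory) : Prop :=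
  forall p, T p -> forall rho eta, sat M rho eta p.

Lemma eval_subst M rho sg t :
  eval M rho (subst_term sg t) = eval M (fun n => eval M rho (sg n)) t.
Proof. induction t; simpl; congruence. Qed.

Lemma eval_shift M a rho t : eval M (scons a rho) (shift_term t) = eval M rho t.
Proof. unfold shift_term. now rewrite eval_subst. Qed.

Lemma eval_upN M a rho sg :
  (fun n => eval M (scons a rho) (upN sg n)) = scons a (fun n => eval M rho (sg n)).
Proof.
  apply functional_extensionality; intros [|n]; simpl; [easy|]. apply eval_shift.
Qed.

Lemma scons_upS A (a : A) eta xi :
  (fun n => scons a eta (upS xi n)) = scons a (fun n => eta (xi n)).
Proof. now apply functional_extensionality; intros [|n]. Qed.

Lemma sat_subst M p : forall rho eta sg xi,
  sat M rho eta (subst sg xi p)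
  <-> sat M (fun n => eval M rho (sg n)) (fun X => eta (xi X)) p.
Proof.
  induction p; intros; simpl; rewrite ?eval_subst; try tauto.
  - now rewrite IHp1, IHp2.
  - setoid_rewrite IHp. now setoid_rewrite eval_upN.
  - setoid_rewrite IHp. now setoid_rewrite scons_upS.
Qed.

(** * Completeness *)

Section Completeness.

Variable T : theory.

(** The calculus has no substitution rule. Generalizing [p] over all its variables gives a closed
    formula, which every substitution fixes; the instantiation axioms then strip the quantifiers one
    at a time, inserting the wanted terms and set variables. *)
Lemma provable_subst p sg xi : provable T p -> provable T (subst sg xi p).
Proof.
  assert (HN : forall n p, (forall sg xi, provable T (subst sg xi (Nat.iter n AllN p))) ->
                           forall sg xi, provable T (subst sg xi p)).
  { intros n; induction n as [|n IH]; intros q H; trivial.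
    apply IH. intros sg' xi'. specialize (H (fun n => sg' (S n)) xi'); simpl in H.
    eapply pr_mp in H; [|apply (pr_instN _ _ (sg' 0))].
    rewrite instN_upN in H. erewrite f_equal; [apply H|].
    f_equal. now apply functional_extensionality; intros [|m]. }
  assert (HS : forall n p, (forall sg xi, provable T (subst sg xi (Nat.iter n AllS p))) ->
                           forall sg xi, provable T (subst sg xi p)).
  { intros n; induction n as [|n IH]; intros q H; trivial.
    apply IH. intros sg' xi'. specialize (H sg' (fun n => xi' (S n))); simpl in H.
    eapply pr_mp in H; [|apply (pr_instS _ _ (xi' 0))].
    rewrite instS_upS in H. erewrite f_equal; [apply H|].
    f_equal. now apply functional_extensionality; intros [|m]. }
  assert (CN : forall n p k s, closed_form (n + k) s p -> closed_form k s (Nat.iter n AllN p)).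
  { intros n; induction n as [|n IH]; intros q k s H; trivial. simpl. apply IH.
    now rewrite Nat.add_succ_r. }
  assert (CS : forall n p k s, closed_form k (n + s) p -> closed_form k s (Nat.iter n AllS p)).
  { intros n; induction n as [|n IH]; intros q k s H; trivial. simpl. apply IH.
    now rewrite Nat.add_succ_r. }
  intros Hp. revert sg xi. apply HN with (bound_form p), HS with (bound_form p).
  intros sg xi.
  rewrite subst_closed with (k := 0) (s := 0) (tau := Var) (zeta := fun X => X);
    try (intros; lia).
  - rewrite subst_id.
    assert (forall n q, provable T q -> provable T (Nat.iter n AllN q)).
    { intros n; induction n; simpl; intros; trivial. now apply pr_genN, IHn. }
    assert (forall n q, provable T q -> provable T (Nat.iter n AllS q)).
    { intros n; induction n; simpl; intros; trivial. now apply pr_genS, IHn. }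
    auto.
  - apply CS, CN, closed_form_bound; lia.
Qed.

(** Generalization is confined to theorems of [T], so the deduction theorem holds without a
    condition on variables. *)
Inductive derives (l : list form) : form -> Prop :=
| de_thm p : provable T p -> derives l p
| de_hyp p : In p l -> derives l p
| de_mp p q : derives l (Imp p q) -> derives l p -> derives l q.

Lemma derives_nil p : derives nil p -> provable T p.
Proof. induction 1; trivial; [easy|]. eapply pr_mp; eauto. Qed.

Lemma deduction a l p : derives (a :: l) p -> derives l (Imp a p).
Proof.
  induction 1 as [p Hp|p [<-|Hp]|p q _ IH1 _ IH2].
  - eapply de_mp; apply de_thm; [apply pr_K|apply Hp].
  - eapply de_mp; [eapply de_mp|]; apply de_thm;
      [apply pr_S|apply pr_K|apply (pr_K _ _ a)].
  - eapply de_mp; [apply de_thm, pr_K|now apply de_hyp].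
  - eapply de_mp; [eapply de_mp; [apply de_thm, pr_S|apply IH1]|apply IH2].
Qed.

Lemma derives_exfalso l p : derives l Bot -> derives l p.
Proof.
  intros H. eapply de_mp; [apply de_thm, pr_dn|].
  eapply de_mp; [apply de_thm, pr_K|apply H].
Qed.

Definition entails (c p : form) : Prop := provable T (Imp c p).

Lemma entails_thm c p : provable T p -> entails c p.
Proof. intros H. eapply pr_mp; [apply pr_K|apply H]. Qed.

Lemma entails_mp c p q : entails c (Imp p q) -> entails c p -> entails c q.
Proof. intros H1 H2. eapply pr_mp; [eapply pr_mp; [apply pr_S|apply H1]|apply H2]. Qed.

Lemma entails_trans c p q : entails c p -> entails p q -> entails c q.
Proof. intros H1 H2. eapply entails_mp; [apply entails_thm, H2|apply H1]. Qed.

Lemma entails_refl c : entails c c.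
Proof. apply derives_nil, deduction, de_hyp. now left. Qed.

Lemma entails_and_l a b : entails (And a b) a.
Proof.
  apply derives_nil, deduction. eapply de_mp; [apply de_thm, pr_dn|].
  apply deduction. apply de_mp with (Imp a (Neg b)); [apply de_hyp; firstorder|].
  apply deduction, derives_exfalso. apply de_mp with a; apply de_hyp; firstorder.
Qed.

Lemma entails_and_r a b : entails (And a b) b.
Proof.
  apply derives_nil, deduction. eapply de_mp; [apply de_thm, pr_dn|].
  apply deduction. apply de_mp with (Imp a (Neg b)); [apply de_hyp; firstorder|].
  apply deduction, de_hyp; firstorder.
Qed.

Lemma entails_dn c p : entails c (Neg (Neg p)) -> entails c p.
Proof. apply entails_mp, entails_thm, pr_dn. Qed.

(** [Neg (And c p)] unfolds to the double negation of [Imp c (Neg p)]. *)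
Lemma refutes_and c p : provable T (Neg (And c p)) -> entails c (Neg p).
Proof. intros H. eapply pr_mp; [apply pr_dn|apply H]. Qed.

(** Renaming the fresh variable [k] to 0 and shifting all others turns [c] into [shiftN c] and the
    instance back into [q]. Generalization, distribution and the vacuous quantifier axiom then
    finish. *)
Lemma generalize_freshN c q k :
  bound_form c <= k -> bound_form q <= k ->
  entails c (instN (Var k) q) -> entails c (AllN q).
Proof.
  intros Hc Hq H.
  set (sg n := if n =? k then Var 0 else Var (S n)).
  apply (provable_subst sg (fun X => X)) in H; simpl in H.
  replace (subst sg (fun X => X) c) with (shiftN c) in H.
  2:{ apply subst_closed with k k; try now apply closed_form_bound.
      - intros n Hn. unfold sg. destruct (Nat.eqb_spec n k); trivial; lia.
      - easy. }
  replace (subst sg _ (instN (Var k) q)) with q in H.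
  2:{ unfold instN. rewrite subst_comp. rewrite <- (subst_id q) at 1.
      apply subst_closed with k k; try now apply closed_form_bound.
      - intros [|n] Hn; simpl; unfold sg.
        + now rewrite Nat.eqb_refl.
        + destruct (Nat.eqb_spec n k); trivial; lia.
      - easy. }
  apply pr_genN in H. eapply pr_mp in H; [|apply pr_distN].
  eapply entails_trans; [apply pr_vacN|apply H].
Qed.

Lemma generalize_freshS c q k :
  bound_form c <= k -> bound_form q <= k ->
  entails c (instS k q) -> entails c (AllS q).
Proof.
  intros Hc Hq H.
  set (xi n := if n =? k then 0 else S n).
  apply (provable_subst Var xi) in H; simpl in H.
  replace (subst Var xi c) with (shiftS c) in H.
  2:{ apply subst_closed with k k; try now apply closed_form_bound.
      - easy.
      - intros n Hn. unfold xi. destruct (Nat.eqb_spec n k); trivial; lia. }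
  replace (subst Var xi (instS k q)) with q in H.
  2:{ unfold instS. rewrite subst_comp. rewrite <- (subst_id q) at 1.
      apply subst_closed with k k; try now apply closed_form_bound.
      - easy.
      - intros [|n] Hn; simpl; unfold xi.
        + now rewrite Nat.eqb_refl.
        + destruct (Nat.eqb_spec n k); trivial; lia. }
  apply pr_genS in H. eapply pr_mp in H; [|apply pr_distS].
  eapply entails_trans; [apply pr_vacS|apply H].
Qed.

Section Henkin.

Variable c0 : form.
Hypothesis c0_consistent : ~ provable T (Neg c0).

(** Free variables that are fresh at each stage serve as the Henkin witnesses. *)
Definition henkin_step (c p : form) : form :=
  if excluded_middle_informative (provable T (Neg (And c p))) then
    match p with
    | AllN q => And c (Neg (instN (Var (max (bound_form c) (bound_form q))) q))
    | AllS q => And c (Neg (instS (max (bound_form c) (bound_form q)) q))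
    | _ => c
    end
  else And c p.

(** Each stage is a single formula, so a fresh index always exists. Axioms of [T] hold as universal
    closures and hence use up no variables. *)
Fixpoint henkin_chain (n : nat) : form :=
  match n with
  | 0 => c0
  | S n => henkin_step (henkin_chain n) (enum_form n)
  end.

(** If adding the negated instance were refutable, [c] would entail the instance at a fresh
    variable, hence the universal formula, whose negation it already entails. *)
Lemma henkin_step_consistent c p :
  ~ provable T (Neg c) -> ~ provable T (Neg (henkin_step c p)).
Proof.
  intros Hc. unfold henkin_step.
  destruct excluded_middle_informative as [H|H]; trivial.
  apply refutes_and in H.
  destruct p; trivial; intros H'; apply Hc; apply refutes_and, entails_dn in H';
    eapply entails_mp; try apply H.
  - eapply generalize_freshN; [| |apply H']; lia.
  - eapply generalize_freshS; [| |apply H']; lia.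
Qed.

Lemma henkin_step_extends c p : entails (henkin_step c p) c.
Proof.
  unfold henkin_step.
  destruct excluded_middle_informative, p;
    try apply entails_and_l; apply entails_refl.
Qed.

Lemma henkin_chain_consistent n : ~ provable T (Neg (henkin_chain n)).
Proof. induction n; simpl; trivial. now apply henkin_step_consistent. Qed.

Lemma henkin_chain_mono n k : entails (henkin_chain (k + n)) (henkin_chain n).
Proof.
  induction k as [|k IH]; [apply entails_refl|].
  eapply entails_trans; [apply henkin_step_extends|apply IH].
Qed.

Definition henkin (p : form) : Prop := exists n, entails (henkin_chain n) p.

Lemma henkin_mp p q : henkin (Imp p q) -> henkin p -> henkin q.
Proof.
  intros [n Hn] [m Hm]. exists (n + m). eapply entails_mp.
  - eapply entails_trans; [|apply Hn]. rewrite Nat.add_comm. apply henkin_chain_mono.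
  - eapply entails_trans; [|apply Hm]. apply henkin_chain_mono.
Qed.

Lemma henkin_thm p : provable T p -> henkin p.
Proof. exists 0. now apply entails_thm. Qed.

Lemma henkin_Bot : ~ henkin Bot.
Proof. intros [n Hn]. now apply (henkin_chain_consistent n). Qed.

Lemma henkin_decides p : henkin p \/ henkin (Neg p).
Proof.
  destruct (enum_form_surj p) as [n Hn].
  destruct (classic (provable T (Neg (And (henkin_chain n) p)))) as [H|H].
  - right. exists n. now apply refutes_and.
  - left. exists (S n). simpl. unfold henkin_step. rewrite Hn.
    destruct excluded_middle_informative; [easy|]. apply entails_and_r.
Qed.

Lemma henkin_Imp p q : henkin (Imp p q) <-> (henkin p -> henkin q).
Proof.
  split; [apply henkin_mp|]. intros H. destruct (henkin_decides p) as [Hp|Hp].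
  - eapply henkin_mp; [apply henkin_thm, pr_K|auto].
  - eapply henkin_mp; [|apply Hp]. apply henkin_thm, derives_nil.
    apply deduction, deduction, derives_exfalso.
    apply de_mp with p; apply de_hyp; firstorder.
Qed.

Lemma henkin_AllN p : henkin (AllN p) <-> forall t, henkin (instN t p).
Proof.
  split.
  - intros H t. eapply henkin_mp; [apply henkin_thm, pr_instN|apply H].
  - intros H. destruct (enum_form_surj (AllN p)) as [n Hn].
    destruct (classic (provable T (Neg (And (henkin_chain n) (AllN p))))) as [H1|H1].
    (* The universal formula was refuted at its stage, so that stage added a negated instance, which
       contradicts [H]. *)
    + exfalso. apply henkin_Bot. eapply henkin_mp; [|apply H].
      exists (S n). simpl. unfold henkin_step. rewrite Hn.
      destruct excluded_middle_informative; [|easy]. apply entails_and_r.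
    + exists (S n). simpl. unfold henkin_step. rewrite Hn.
      destruct excluded_middle_informative; [easy|]. apply entails_and_r.
Qed.

Lemma henkin_AllS p : henkin (AllS p) <-> forall X, henkin (instS X p).
Proof.
  split.
  - intros H t. eapply henkin_mp; [apply henkin_thm, pr_instS|apply H].
  - intros H. destruct (enum_form_surj (AllS p)) as [n Hn].
    destruct (classic (provable T (Neg (And (henkin_chain n) (AllS p))))) as [H1|H1].
    + exfalso. apply henkin_Bot. eapply henkin_mp; [|apply H].
      exists (S n). simpl. unfold henkin_step. rewrite Hn.
      destruct excluded_middle_informative; [|easy]. apply entails_and_r.
    + exists (S n). simpl. unfold henkin_step. rewrite Hn.
      destruct excluded_middle_informative; [easy|]. apply entails_and_r.
Qed.

Definition heq (t u : term) : Prop := henkin (Eq t u).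

Lemma heq_refl t : heq t t.
Proof. apply henkin_thm, pr_refl. Qed.

Lemma heq_leibniz p t u : heq t u -> henkin (instN t p) -> henkin (instN u p).
Proof. intros H. apply henkin_mp. eapply henkin_mp; [apply henkin_thm, pr_leibniz|apply H]. Qed.

Lemma inst_shift_Var u t : subst_term (scons u Var) (shift_term t) = t.
Proof. now rewrite inst_shift_term, subst_term_Var. Qed.

Lemma heq_sym t u : heq t u -> heq u t.
Proof.
  intros H. apply (heq_leibniz (Eq (Var 0) (shift_term t))) in H;
    unfold instN in *; simpl in *; rewrite inst_shift_Var in *; trivial.
  apply heq_refl.
Qed.

Lemma heq_trans t u v : heq t u -> heq u v -> heq t v.
Proof.
  intros H1 H2. apply (heq_leibniz (Eq (shift_term t) (Var 0))) in H2;
    unfold instN in *; simpl in *; rewrite inst_shift_Var in *; trivial.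
Qed.

Lemma heq_binary (F : term -> term -> term) t t' u u' :
  (forall sg a b, subst_term sg (F a b) = F (subst_term sg a) (subst_term sg b)) ->
  heq t t' -> heq u u' -> heq (F t u) (F t' u').
Proof.
  intros HF Ht Hu. apply heq_trans with (F t' u).
  - apply (heq_leibniz (Eq (shift_term (F t u)) (F (Var 0) (shift_term u)))) in Ht;
      unfold instN in *; simpl in *; rewrite ?HF, ?inst_shift_Var in *; trivial.
    apply heq_refl.
  - apply (heq_leibniz (Eq (shift_term (F t' u)) (F (shift_term t') (Var 0)))) in Hu;
      unfold instN in *; simpl in *; rewrite ?HF, ?inst_shift_Var in *; trivial.
    apply heq_refl.
Qed.

(** [sat] reads [Eq] as true equality, so terms must be identified up to [heq]. Equivalent terms
    have extensionally equal predicates [heq t], on which [epsilon] makes the same choice. *)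
Definition rep (t : term) : term := epsilon (inhabits Zero) (heq t).

Lemma rep_heq t : heq t (rep t).
Proof. apply (epsilon_spec (inhabits Zero) (heq t)). exists t. apply heq_refl. Qed.

Lemma rep_eq t u : rep t = rep u <-> heq t u.
Proof.
  split; intros H.
  - apply heq_trans with (rep t); [apply rep_heq|]. rewrite H. apply heq_sym, rep_heq.
  - unfold rep. f_equal. apply functional_extensionality; intros v.
    apply propositional_extensionality; split; apply heq_trans; trivial.
    now apply heq_sym.
Qed.

Definition hnum : Type := {t : term | rep t = t}.

Lemma rep_idem t : rep (rep t) = rep t.
Proof. apply rep_eq, heq_sym, rep_heq. Qed.

Definition cls (t : term) : hnum := exist _ (rep t) (rep_idem t).

Lemma cls_eq t u : cls t = cls u <-> heq t u.
Proof.
  rewrite <- rep_eq. split; intros H.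
  - now injection H.
  - unfold cls. apply eq_sig_hprop; trivial. intros; apply proof_irrelevance.
Qed.

Lemma cls_rep (a : hnum) : cls (proj1_sig a) = a.
Proof.
  destruct a as [t Ht]. apply eq_sig_hprop; trivial. intros; apply proof_irrelevance.
Qed.

Definition henkin_model : model := {|
  num := hnum;
  st := nat;
  m0 := cls Zero;
  m1 := cls One;
  madd a b := cls (Add (proj1_sig a) (proj1_sig b));
  mmul a b := cls (Mul (proj1_sig a) (proj1_sig b));
  mlt a b := henkin (Lt (proj1_sig a) (proj1_sig b));
  mem a X := henkin (Mem (proj1_sig a) X) |}.

Lemma henkin_eval sg t :
  eval henkin_model (fun n => cls (sg n)) t = cls (subst_term sg t).
Proof.
  induction t; simpl; trivial; rewrite IHt1, IHt2; apply cls_eq;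
    apply heq_sym; apply heq_binary; trivial; apply rep_heq.
Qed.

Lemma henkin_Lt_rep t u : henkin (Lt (rep t) (rep u)) <-> henkin (Lt t u).
Proof.
  assert (H : forall t t' u u', heq t t' -> heq u u' -> henkin (Lt t u) -> henkin (Lt t' u')).
  { intros a a' b b' Ha Hb H.
    apply (heq_leibniz (Lt (Var 0) (shift_term b))) in Ha;
      unfold instN in *; simpl in *; rewrite ?inst_shift_Var in *; trivial.
    apply (heq_leibniz (Lt (shift_term a') (Var 0))) in Hb;
      unfold instN in *; simpl in *; rewrite ?inst_shift_Var in *; trivial. }
  split; apply H; try apply rep_heq; apply heq_sym, rep_heq.
Qed.

Lemma henkin_Mem_rep t X : henkin (Mem (rep t) X) <-> henkin (Mem t X).
Proof.
  split.
  - apply (heq_leibniz (Mem (Var 0) X) (heq_sym (rep_heq t))).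
  - apply (heq_leibniz (Mem (Var 0) X) (rep_heq t)).
Qed.

Lemma henkin_truth p : forall sg xi,
  sat henkin_model (fun n => cls (sg n)) xi p <-> henkin (subst sg xi p).
Proof.
  induction p; intros sg xi; cbn [sat subst]; rewrite ?henkin_eval.
  - apply cls_eq.
  - apply henkin_Lt_rep.
  - apply henkin_Mem_rep.
  - split; [easy|apply henkin_Bot].
  - now rewrite henkin_Imp, IHp1, IHp2.
  - rewrite henkin_AllN.
    assert (E : forall t, sat henkin_model (scons (cls t) (fun n => cls (sg n))) xi p
                          <-> henkin (instN t (subst (upN sg) xi p))).
    { intros t. rewrite instN_upN, <- IHp. erewrite f_equal; [reflexivity|].
      f_equal. now apply functional_extensionality; intros [|n]. }
    split.
    + intros H t. apply E, H.
    + intros H a. rewrite <- (cls_rep a). apply E, H.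
  - rewrite henkin_AllS. split; intros H X; specialize (H X).
    + now rewrite instS_upS, <- IHp.
    + now rewrite instS_upS, <- IHp in H.
Qed.

End Henkin.

Theorem completeness p :
  (forall M, models M T -> forall rho eta, sat M rho eta p) -> provable T p.
Proof.
  intros H. apply NNPP; intros Hp.
  assert (Hc : ~ provable T (Neg (Neg p))).
  { intros H1. apply Hp. eapply pr_mp; [apply pr_dn|apply H1]. }
  assert (Hm : models (henkin_model (Neg p)) T).
  { intros q Hq rho eta.
    (* Any environment is the class of its representatives, so the truth lemma applies with these as
       the substitution. *)
    replace rho with (fun n => cls (Neg p) (proj1_sig (rho n)))
      by (apply functional_extensionality; intros n; apply cls_rep).
    apply (henkin_truth Hc), henkin_thm, provable_subst, pr_ax, Hq. }
  specialize (H _ Hm (fun n => cls (Neg p) (Var n)) (fun X => X)).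
  apply (henkin_truth Hc) in H. rewrite subst_id in H.
  apply (henkin_Bot Hc). eapply henkin_mp; [|apply H].
  exists 0. apply entails_refl.
Qed.

End Completeness.

(** * Definability with parameters in a model *)

Lemma sat_And M rho eta p q :
  sat M rho eta (And p q) <-> sat M rho eta p /\ sat M rho eta q.
Proof. simpl. tauto. Qed.

Lemma sat_Iff M rho eta p q :
  sat M rho eta (Iff p q) <-> (sat M rho eta p <-> sat M rho eta q).
Proof. simpl. tauto. Qed.

Lemma sat_ExN M rho eta p :
  sat M rho eta (ExN p) <-> exists a, sat M (scons a rho) eta p.
Proof.
  simpl. split.
  - intros H. apply NNPP. intros H1. apply H. intros a Ha. apply H1. now exists a.
  - intros [a Ha] H. now apply (H a).
Qed.

Lemma sat_ExS M rho eta p :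
  sat M rho eta (ExS p) <-> exists A, sat M rho (scons A eta) p.
Proof.
  simpl. split.
  - intros H. apply NNPP. intros H1. apply H. intros a Ha. apply H1. now exists a.
  - intros [a Ha] H. now apply (H a).
Qed.

Lemma sat_instN M rho eta t p :
  sat M rho eta (instN t p) <-> sat M (scons (eval M rho t) rho) eta p.
Proof.
  unfold instN. rewrite sat_subst. erewrite f_equal; [reflexivity|].
  f_equal. now apply functional_extensionality; intros [|n].
Qed.

Lemma sat_shiftS M rho eta A p :
  sat M rho (scons A eta) (shiftS p) <-> sat M rho eta p.
Proof. unfold shiftS. rewrite sat_subst. reflexivity. Qed.

Lemma bounded_subst p sg xi : bounded_form p -> bounded_form (subst sg xi p).
Proof.
  intros H; revert sg xi.
  induction H; intros sg xi; simpl; try (constructor; auto; fail).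
  rewrite subst_shift_term. constructor; auto.
Qed.

(** Two formulas with separate parameters are brought under one valuation: one takes the even
    indices, the other the odd ones. *)
Definition interleave {A} (f g : nat -> A) (n : nat) : A :=
  if Nat.even n then f (Nat.div2 n) else g (Nat.div2 n).

Lemma interleave_l A (f g : nat -> A) : (fun n => interleave f g (2 * n)) = f.
Proof.
  apply functional_extensionality; intros n. unfold interleave.
  now rewrite Nat.even_mul, Nat.div2_double.
Qed.

Lemma interleave_r A (f g : nat -> A) : (fun n => interleave f g (S (2 * n))) = g.
Proof.
  apply functional_extensionality; intros n. unfold interleave.
  now rewrite Nat.even_succ, Nat.odd_mul, Nat.div2_succ_double.
Qed.

Section Definability.

Variable M : model.
Variable A0 : st M.

Notation env := (nat -> num M).

(** Parameters from the model enter through [inr]. *)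
Definition valuation (s : nat -> nat + num M) (rho : env) : env :=
  fun n => match s n with inl i => rho i | inr a => a end.

Definition polynomial (f : env -> num M) : Prop :=
  exists t s, forall rho, f rho = eval M (valuation s rho) t.

Definition delta0 (P : env -> Prop) : Prop :=
  exists q s eta, bounded_form q /\
    forall rho, P rho <-> sat M (valuation s rho) eta q.

Definition sigma1 (P : env -> Prop) : Prop :=
  exists Q, delta0 Q /\ forall rho, P rho <-> exists x, Q (scons x rho).

Definition rename_term (r : nat -> nat) : term -> term := subst_term (fun n => Var (r n)).
Definition rename (r : nat -> nat) : (nat -> nat) -> form -> form := subst (fun n => Var (r n)).

Lemma eval_rename_l s s' rho t :
  eval M (valuation (interleave s s') rho) (rename_term (fun n => 2 * n) t)
  = eval M (valuation s rho) t.
Proof.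
  unfold rename_term. rewrite eval_subst. cbn [eval].
  replace (valuation s rho) with (valuation (fun n => interleave s s' (2 * n)) rho)
    by now rewrite interleave_l.
  reflexivity.
Qed.

Lemma eval_rename_r s s' rho t :
  eval M (valuation (interleave s s') rho) (rename_term (fun n => S (2 * n)) t)
  = eval M (valuation s' rho) t.
Proof.
  unfold rename_term. rewrite eval_subst. cbn [eval].
  replace (valuation s' rho) with (valuation (fun n => interleave s s' (S (2 * n))) rho)
    by now rewrite interleave_r.
  reflexivity.
Qed.

Lemma sat_rename_l s s' eta eta' rho p :
  sat M (valuation (interleave s s') rho) (interleave eta eta')
    (rename (fun n => 2 * n) (fun n => 2 * n) p)
  <-> sat M (valuation s rho) eta p.
Proof.
  unfold rename. rewrite sat_subst. cbn [eval]. rewrite interleave_l.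
  replace (valuation s rho) with (valuation (fun n => interleave s s' (2 * n)) rho)
    by now rewrite interleave_l.
  reflexivity.
Qed.

Lemma sat_rename_r s s' eta eta' rho p :
  sat M (valuation (interleave s s') rho) (interleave eta eta')
    (rename (fun n => S (2 * n)) (fun n => S (2 * n)) p)
  <-> sat M (valuation s' rho) eta' p.
Proof.
  unfold rename. rewrite sat_subst. cbn [eval]. rewrite interleave_r.
  replace (valuation s' rho) with (valuation (fun n => interleave s s' (S (2 * n))) rho)
    by now rewrite interleave_r.
  reflexivity.
Qed.

Lemma polynomial_pair f g :
  polynomial f -> polynomial g ->
  exists t u s, forall rho,
    f rho = eval M (valuation s rho) t /\ g rho = eval M (valuation s rho) u.
Proof.
  intros (t & s & Ht) (u & s' & Hu).
  exists (rename_term (fun n => 2 * n) t), (rename_term (fun n => S (2 * n)) u),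
    (interleave s s').
  intros rho. now rewrite eval_rename_l, eval_rename_r.
Qed.

Lemma delta0_pair P Q :
  delta0 P -> delta0 Q ->
  exists p q s eta, bounded_form p /\ bounded_form q /\ forall rho,
    (P rho <-> sat M (valuation s rho) eta p) /\ (Q rho <-> sat M (valuation s rho) eta q).
Proof.
  intros (p & s & eta & Bp & Hp) (q & s' & eta' & Bq & Hq).
  exists (rename (fun n => 2 * n) (fun n => 2 * n) p),
    (rename (fun n => S (2 * n)) (fun n => S (2 * n)) q),
    (interleave s s'), (interleave eta eta').
  split; [now apply bounded_subst|]. split; [now apply bounded_subst|].
  intros rho. now rewrite sat_rename_l, sat_rename_r.
Qed.

(** Several variables of a formula may be sent to index 0. The renaming [r] merges them into the
    single variable 0, which one quantifier can bind. *)
Lemma valuation_scons s :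
  exists r s', forall x rho,
    valuation s (scons x rho) = fun n => scons x (valuation s' rho) (r n).
Proof.
  exists (fun n => match s n with inl 0 => 0 | _ => S n end),
    (fun n => match s n with inl i => inl (pred i) | inr a => inr a end).
  intros x rho. apply functional_extensionality; intros n. unfold valuation.
  destruct (s n) as [[|i]|a] eqn:E; simpl; now rewrite ?E.
Qed.

Lemma polynomial_var i : polynomial (fun rho => rho i).
Proof. now exists (Var 0), (fun _ => inl i). Qed.

Lemma polynomial_const a : polynomial (fun _ => a).
Proof. now exists (Var 0), (fun _ => inr a). Qed.

Lemma polynomial_add f g :
  polynomial f -> polynomial g -> polynomial (fun rho => madd M (f rho) (g rho)).
Proof.
  intros Hf Hg. destruct (polynomial_pair Hf Hg) as (t & u & s & H).
  exists (Add t u), s. intros rho. destruct (H rho) as [-> ->]. easy.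
Qed.

Lemma polynomial_mul f g :
  polynomial f -> polynomial g -> polynomial (fun rho => mmul M (f rho) (g rho)).
Proof.
  intros Hf Hg. destruct (polynomial_pair Hf Hg) as (t & u & s & H).
  exists (Mul t u), s. intros rho. destruct (H rho) as [-> ->]. easy.
Qed.

Lemma polynomial_shift f : polynomial f -> polynomial (fun rho => f (fun n => rho (S n))).
Proof.
  intros (t & s & Ht).
  exists t, (fun n => match s n with inl i => inl (S i) | inr a => inr a end).
  intros rho. rewrite Ht. f_equal. apply functional_extensionality; intros n.
  unfold valuation. now destruct (s n).
Qed.

Lemma delta0_ext P Q : (forall rho, P rho <-> Q rho) -> delta0 Q -> delta0 P.
Proof.
  intros H (q & s & eta & Bq & Hq). exists q, s, eta; split; trivial.
  intros rho. now rewrite H.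
Qed.

Lemma delta0_eq f g :
  polynomial f -> polynomial g -> delta0 (fun rho => f rho = g rho).
Proof.
  intros Hf Hg. destruct (polynomial_pair Hf Hg) as (t & u & s & H).
  exists (Eq t u), s, (fun _ => A0). split; [constructor|].
  intros rho. now destruct (H rho) as [-> ->].
Qed.

Lemma delta0_lt f g :
  polynomial f -> polynomial g -> delta0 (fun rho => mlt M (f rho) (g rho)).
Proof.
  intros Hf Hg. destruct (polynomial_pair Hf Hg) as (t & u & s & H).
  exists (Lt t u), s, (fun _ => A0). split; [constructor|].
  intros rho. now destruct (H rho) as [-> ->].
Qed.

Lemma delta0_mem f A : polynomial f -> delta0 (fun rho => mem M (f rho) A).
Proof.
  intros (t & s & H). exists (Mem t 0), s, (fun _ => A). split; [constructor|].
  intros rho. now rewrite H.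
Qed.

Lemma delta0_False : delta0 (fun _ => False).
Proof. exists Bot, (fun _ => inl 0), (fun _ => A0). split; [constructor|easy]. Qed.

Lemma delta0_imp P Q : delta0 P -> delta0 Q -> delta0 (fun rho => P rho -> Q rho).
Proof.
  intros HP HQ. destruct (delta0_pair HP HQ) as (p & q & s & eta & Bp & Bq & H).
  exists (Imp p q), s, eta. split; [now constructor|].
  intros rho. now destruct (H rho) as [-> ->].
Qed.

Lemma delta0_not P : delta0 P -> delta0 (fun rho => ~ P rho).
Proof. intros HP. apply (delta0_imp HP delta0_False). Qed.

Lemma delta0_and P Q : delta0 P -> delta0 Q -> delta0 (fun rho => P rho /\ Q rho).
Proof.
  intros HP HQ. apply delta0_ext with (fun rho => ~ (P rho -> ~ Q rho)).
  - intros rho. tauto.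
  - now apply delta0_not, delta0_imp, delta0_not.
Qed.

Lemma delta0_or P Q : delta0 P -> delta0 Q -> delta0 (fun rho => P rho \/ Q rho).
Proof.
  intros HP HQ. apply delta0_ext with (fun rho => ~ P rho -> Q rho).
  - intros rho. tauto.
  - now apply delta0_imp; [apply delta0_not|].
Qed.

Lemma delta0_iff P Q : delta0 P -> delta0 Q -> delta0 (fun rho => P rho <-> Q rho).
Proof. intros HP HQ. now apply delta0_and; apply delta0_imp. Qed.

Lemma delta0_all_lt f P :
  polynomial f -> delta0 (fun rho => P (fun n => rho (S n)) (rho 0)) ->
  delta0 (fun rho => forall x, mlt M x (f rho) -> P rho x).
Proof.
  intros (t & s & Ht) (q & s' & eta & Bq & Hq).
  destruct (valuation_scons s') as (r & s'' & Hr).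
  exists (AllN (Imp (Lt (Var 0) (shift_term (rename_term (fun n => 2 * n) t)))
    (subst (upN (fun n => Var (S (2 * n)))) (fun X => X)
       (rename r (fun X => X) q)))), (interleave s s''), eta.
  split.
  - now constructor; apply bounded_subst, bounded_subst.
  - intros rho. cbn [sat eval].
    enough (E : forall x,
      (mlt M x (eval M (scons x (valuation (interleave s s'') rho))
                  (shift_term (rename_term (fun n => 2 * n) t))) <-> mlt M x (f rho))
      /\ (sat M (scons x (valuation (interleave s s'') rho)) eta
           (subst (upN (fun n => Var (S (2 * n)))) (fun X => X)
              (rename r (fun X => X) q)) <-> P rho x)) by (cbn [scons]; firstorder).
    intros x. rewrite eval_shift, eval_rename_l, <- Ht. split; [easy|].
    unfold rename. rewrite !sat_subst, eval_upN. cbn [eval].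
    rewrite (Hq (scons x rho)), Hr.
    replace (valuation s'' rho)
      with (valuation (fun n => interleave s s'' (S (2 * n))) rho)
      by now rewrite interleave_r.
    reflexivity.
Qed.

Lemma delta0_ex_lt f P :
  polynomial f -> delta0 (fun rho => P (fun n => rho (S n)) (rho 0)) ->
  delta0 (fun rho => exists x, mlt M x (f rho) /\ P rho x).
Proof.
  intros Hf HP.
  apply delta0_ext with (fun rho => ~ forall x, mlt M x (f rho) -> ~ P rho x).
  - intros rho. split.
    + intros (x & Hx & H) H1. now apply (H1 x).
    + intros H. apply NNPP. intros H1. apply H. intros x Hx Px. apply H1. now exists x.
  - apply delta0_not, delta0_all_lt; trivial. now apply delta0_not.
Qed.

Lemma sigma1_ext P Q : (forall rho, P rho <-> Q rho) -> sigma1 Q -> sigma1 P.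
Proof.
  intros H (R & HR & E). exists R; split; trivial. intros rho. now rewrite H.
Qed.

Lemma delta0_valuation g P : delta0 P -> delta0 (fun rho => P (valuation g rho)).
Proof.
  intros (q & s & eta & Bq & Hq).
  exists q, (fun n => match s n with inl i => g i | inr a => inr a end), eta.
  split; trivial. intros rho. rewrite Hq. erewrite f_equal; [reflexivity|].
  f_equal. apply functional_extensionality; intros n. unfold valuation.
  now destruct (s n).
Qed.

Lemma sigma1_delta0 P : delta0 P -> sigma1 P.
Proof.
  intros HP. exists (fun rho => P (fun n => rho (S n))). split.
  - apply (delta0_valuation (fun n => inl (S n)) HP).
  - intros rho. split; [intros H; now exists (m0 M)|now intros [x H]].
Qed.

(** The matrix of a [sigma1] predicate may read the whole environment. Freezing all but two entries
    at 0 leaves a binary relation of the argument and the witness. *)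
Definition first_two (x y : num M) : env := scons y (scons x (fun _ => m0 M)).

Lemma delta0_first_two P :
  delta0 P -> delta0 (fun rho => P (first_two (rho 1) (rho 0))).
Proof.
  intros HP. apply delta0_ext with (2 := delta0_valuation
    (scons (inl 0) (scons (inl 1) (fun _ => inr (m0 M)))) HP).
  intros rho. replace (first_two (rho 1) (rho 0)) with
    (valuation (scons (inl 0) (scons (inl 1) (fun _ => inr (m0 M)))) rho); [easy|].
  now apply functional_extensionality; intros [|[|n]].
Qed.

(** The two variables of [P] and [Q] become the variables [1] and [0] of the
    formulas, whose other variables carry the parameters. *)
Lemma delta0_forms (P Q : num M -> num M -> Prop) :
  delta0 (fun rho => P (rho 1) (rho 0)) -> delta0 (fun rho => Q (rho 1) (rho 0)) ->
  exists p q c eta, bounded_form p /\ bounded_form q /\ forall x y,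
    (P x y <-> sat M (scons y (scons x c)) eta p)
    /\ (Q x y <-> sat M (scons y (scons x c)) eta q).
Proof.
  intros HP HQ. destruct (delta0_pair HP HQ) as (p & q & s & eta & Bp & Bq & H).
  destruct (valuation_scons s) as (r & s' & Hr).
  destruct (valuation_scons s') as (r' & s'' & Hr').
  assert (E : forall x y p,
    sat M (valuation s (scons y (scons x (fun _ => m0 M)))) eta p
    <-> sat M (scons y (scons x (valuation s'' (fun _ => m0 M)))) eta
       (subst (upN (fun n => Var (r' n))) (fun X => X) (rename r (fun X => X) p))).
  { intros x y p'. unfold rename. rewrite !sat_subst, eval_upN. cbn [eval].
    now rewrite Hr, Hr'. }
  eexists _, _, _, eta. split; [|split]; [| |intros x y; split].
  3: rewrite <- E; apply (H (scons y (scons x (fun _ => m0 M)))).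
  3: rewrite <- E; apply (H (scons y (scons x (fun _ => m0 M)))).
  all: now apply bounded_subst, bounded_subst.
Qed.

Hypothesis HM : models M RCA0.

Lemma sigma1_induction (P : num M -> Prop) :
  sigma1 (fun rho => P (rho 0)) ->
  P (m0 M) -> (forall x, P x -> P (madd M x (m1 M))) -> forall x, P x.
Proof.
  intros (Q & HQ & E) P0 PS.
  set (Q' x y := Q (first_two x y)).
  assert (HQ' : delta0 (fun rho => Q' (rho 1) (rho 0))) by now apply delta0_first_two.
  destruct (delta0_forms Q' Q' HQ' HQ') as (p & q & c & eta & Bp & Bq & H).
  assert (E' : forall x, P x <-> sat M (scons x c) eta (ExN p)).
  { intros x. rewrite (E (scons x (fun _ => m0 M))), sat_ExN.
    split; intros [y Hy]; exists y; apply (proj1 (H x y)), Hy. }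
  intros x. apply E'. revert x.
  assert (I := @HM _ (rca_induction (ex_intro _ p (conj Bp eq_refl))) c eta).
  apply I. rewrite sat_And, sat_instN. split; [now apply E'|].
  intros x Hx. rewrite sat_subst. apply E', PS, E' in Hx.
  match goal with |- sat _ ?r _ _ => replace r with (scons (madd M x (m1 M)) c) end;
    trivial.
  now apply functional_extensionality; intros [|n].
Qed.

Lemma delta0_induction (P : num M -> Prop) :
  delta0 (fun rho => P (rho 0)) ->
  P (m0 M) -> (forall x, P x -> P (madd M x (m1 M))) -> forall x, P x.
Proof. intros HP. now apply sigma1_induction, sigma1_delta0. Qed.

Lemma delta1_comprehension (P : num M -> Prop) :
  sigma1 (fun rho => P (rho 0)) -> sigma1 (fun rho => ~ P (rho 0)) ->
  exists X, forall x, mem M x X <-> P x.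
Proof.
  intros (Q & HQ & E) (R & HR & F).
  destruct (delta0_forms (fun x y => Q (first_two x y))
    (fun x y => R (first_two x y)) (delta0_first_two HQ) (delta0_first_two HR)) as (p & q & c & eta & Bp & Bq & H).
  assert (E' : forall x, P x <-> sat M (scons x c) eta (ExN p)).
  { intros x. rewrite (E (scons x (fun _ => m0 M))), sat_ExN.
    split; intros [y Hy]; exists y; apply (proj1 (H x y)), Hy. }
  (* Negating the Sigma^0_1 definition of the complement gives the Pi^0_1 form that the axiom asks
     for. *)
  assert (F' : forall x, P x <-> sat M (scons x c) eta (AllN (Neg q))).
  { intros x. split.
    - intros Px y Hy. apply (proj2 (H x y)), (ex_intro (fun y => R (first_two x y)) y) in Hy.
      now apply (F (scons x (fun _ => m0 M))) in Hy.
    - intros Hx. apply NNPP. intros N.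
      apply (F (scons x (fun _ => m0 M))) in N as [y Hy]. apply (Hx y), (proj2 (H x y)), Hy. }
  assert (C := @HM _ (rca_comprehension (ex_intro _ p (conj Bp eq_refl))
    (ex_intro _ (Neg q) (conj (bf_imp Bq bf_bot) eq_refl))) c eta).
  assert (C' : sat M c eta (comprehension_for (ExN p))).
  { apply C. intros x. rewrite sat_Iff, <- E'. apply F'. }
  apply sat_ExS in C' as [X HX].
  exists X. intros x. specialize (HX x). rewrite sat_Iff, sat_shiftS, <- E' in HX.
  apply HX.
Qed.

Lemma delta0_comprehension (P : num M -> Prop) :
  delta0 (fun rho => P (rho 0)) -> exists X, forall x, mem M x X <-> P x.
Proof.
  intros HP. apply delta1_comprehension; apply sigma1_delta0; trivial.
  now apply delta0_not.
Qed.

End Definability.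

Arguments polynomial {M} f.
Arguments delta0 {M} P.
Arguments sigma1 {M} P.
Arguments valuation {M} s rho n.
Arguments first_two {M} x y n.
Arguments delta0_valuation {M} g {P} HP.

(** * Arithmetic in a model of RCA_0 *)

Declare Scope num_scope.
Delimit Scope num_scope with num.

(** Capitalised names are the truth conditions in [M] of the formulas of [Defs]. *)
Section Truth.

Variable M : model.

Local Notation "0" := (m0 M) : num_scope.
Local Notation "1" := (m1 M) : num_scope.
Local Infix "+" := (madd M) : num_scope.
Local Infix "*" := (mmul M) : num_scope.
Local Infix "<" := (mlt M) : num_scope.
Local Open Scope num_scope.

Implicit Types (P : num M -> Prop) (A : st M).
Implicit Types x y z w a b c i j k l m n : num M.

Definition Pair i j : num M := (i + j) * (i + j) + i.

Definition In_triple i k m n : Prop := i < k /\ exists q, n = q * (m * (i + 1) + 1).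

Definition Is_triple z : Prop := exists k m n, z = Pair k (Pair m n).

Definition In_fin i z : Prop :=
  exists k m n, z = Pair k (Pair m n) /\ In_triple i k m n.

Definition Is_code z : Prop :=
  Is_triple z /\
  forall w, w < z /\ Is_triple w -> ~ (forall i, In_fin i w <-> In_fin i z).

Definition Fin_subset_of A c : Prop := Is_code c /\ forall i, In_fin i c -> mem M i A.

Definition Fin_sub a b : Prop := forall i, In_fin i a -> In_fin i b.

Definition Is_function F P Q : Prop :=
  (forall p, F p -> exists x y, P x /\ Q y /\ p = Pair x y) /\
  (forall x, P x -> exists y, F (Pair x y)) /\
  (forall x y z, F (Pair x y) /\ F (Pair x z) -> y = z).

Definition Is_bijection F P Q : Prop :=
  Is_function F P Q /\
  (forall x y z, F (Pair x z) /\ F (Pair y z) -> x = y) /\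
  (forall y, Q y -> exists x, F (Pair x y)).

Definition Card_is c k : Prop :=
  exists f, Is_code f /\
    Is_bijection (fun p => In_fin p f) (fun i => i < k) (fun x => In_fin x c).

Definition Card_lt a b : Prop := exists k l, Card_is a k /\ Card_is b l /\ k < l.

Definition Exchange G (dep : num M -> Prop) : Prop :=
  forall a b,
    Fin_subset_of G a /\ Fin_subset_of G b /\ Card_lt a b /\ ~ dep a /\ ~ dep b ->
    exists y, In_fin y b /\
      ~ (exists c, Is_code c /\ (forall i, In_fin i c <-> In_fin i a \/ i = y) /\ dep c).

Definition In_range e c : Prop := exists n, mem M (Pair n c) e.

Definition Is_ematroid G e : Prop :=
  Is_function (fun p => mem M p e) (fun n => n = n) (fun c => Fin_subset_of G c) /\
  (forall n c, mem M (Pair n c) e -> exists i, In_fin i c) /\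
  (forall n c b, mem M (Pair n c) e /\ Fin_subset_of G b /\ Fin_sub c b -> In_range e b) /\
  Exchange G (In_range e).

Definition Is_matroid N D : Prop :=
  (forall c, mem M c D -> Fin_subset_of N c) /\
  (forall c, mem M c D -> exists i, In_fin i c) /\
  (forall c b, mem M c D /\ Fin_subset_of N b /\ Fin_sub c b -> mem M b D) /\
  Exchange N (fun c => mem M c D).

Definition Is_isomorphism G e N D h : Prop :=
  Is_bijection (fun p => mem M p h) (fun x => mem M x G) (fun y => mem M y N) /\
  (forall a, Fin_subset_of G a ->
    (In_range e a <->
     exists c, Is_code c /\
       (forall y, In_fin y c <-> exists x, In_fin x a /\ mem M (Pair x y) h) /\
       mem M c D)).

Definition Every_ematroid_isomorphic_to_matroid : Prop :=
  forall G e, Is_ematroid G e ->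
    exists N D h, Is_matroid N D /\ Is_isomorphism G e N D h.

End Truth.

(** * Truth of the formalized sentence in a model *)

Lemma encoded_and (A A' B B' : Prop) :
  (A <-> A') -> (B <-> B') -> (((A -> B -> False) -> False) <-> A' /\ B').
Proof. tauto. Qed.

Lemma encoded_or (A A' B B' : Prop) :
  (A <-> A') -> (B <-> B') -> (((A -> False) -> B) <-> A' \/ B').
Proof. tauto. Qed.

Lemma encoded_ex X (P P' : X -> Prop) :
  (forall x, P x <-> P' x) -> (((forall x, P x -> False) -> False) <-> exists x, P' x).
Proof.
  intros H. split.
  - intros N. apply NNPP. intros N'. apply N. intros x Px. apply N'. exists x. now apply H.
  - intros [x Px] N. apply (N x). now apply H.
Qed.

Lemma encoded_all X (P P' : X -> Prop) :
  (forall x, P x <-> P' x) -> ((forall x, P x) <-> forall x, P' x).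
Proof. firstorder. Qed.

Lemma encoded_imp (A A' B B' : Prop) :
  (A <-> A') -> (B <-> B') -> ((A -> B) <-> (A' -> B')).
Proof. tauto. Qed.

(** [Defs] and the truth conditions have the same shape, up to the encoding of the
    connectives by [Imp], [Bot], [AllN] and [AllS]. *)
Ltac decode :=
  repeat
    match goal with
    | |- ?L <-> ?R =>
      let R' := eval hnf in R in
      change (L <-> R');
      lazymatch R' with
      | _ /\ _ => apply encoded_and
      | _ \/ _ => apply encoded_or
      | ex _ => apply encoded_ex; intro
      | False => reflexivity
      | ?A -> ?B => apply encoded_imp
      | forall x, _ => apply encoded_all; intro
      | _ => reflexivity
      end
    end.

Lemma sat_sentence M rho eta :
  sat M rho eta (sentence every_ematroid_isomorphic_to_matroid)
  <-> Every_ematroid_isomorphic_to_matroid M.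
Proof.
  match goal with |- ?L <-> _ => let L' := eval lazy in L in change L with L' end.
  decode.
Qed.

Ltac polynomial :=
  repeat first
    [ simple apply polynomial_const | simple apply polynomial_var
    | simple apply polynomial_add | simple apply polynomial_mul ].

(** Redefined below, once the predicates on coded finite sets are known to be [delta0]. *)
Ltac definable_hook := fail.

Ltac definable :=
  repeat first
    [ progress (polynomial)
    | definable_hook
    | simple apply delta0_eq | simple apply delta0_lt | simple apply delta0_mem
    | simple apply delta0_iff
    | simple apply delta0_and | simple apply delta0_or
    | simple apply delta0_not
    | simple apply delta0_all_lt | simple apply delta0_ex_lt
    | simple apply delta0_imp
    | simple apply delta0_False
    | eassumption ]; cbn beta; trivial.

Section Arithmetic.

Variable M : model.
Variable A0 : st M.
Hypothesis HM : models M RCA0.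

Local Notation "0" := (m0 M) : num_scope.
Local Notation "1" := (m1 M) : num_scope.
Local Infix "+" := (madd M) : num_scope.
Local Infix "*" := (mmul M) : num_scope.
Local Infix "<" := (mlt M) : num_scope.
Local Open Scope num_scope.

Implicit Types x y z u v w a b c i j k l : num M.

(** * The ordered semiring of numbers *)

Lemma rca_sat p rho : basic_axiom p -> sat M rho (fun _ => A0) p.
Proof. intros H. now apply HM, rca_basic. Qed.

Definition two x y : nat -> num M := scons x (fun _ => y).

Lemma succ_ne0 x : x + 1 <> 0.
Proof. exact (@rca_sat _ (two x x) ba_succ_ne0). Qed.

Lemma succ_inj x y : x + 1 = y + 1 -> x = y.
Proof. exact (@rca_sat _ (two x y) ba_succ_inj). Qed.

Lemma num_add_0 x : x + 0 = x.
Proof. exact (@rca_sat _ (two x x) ba_add0). Qed.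

Lemma num_add_succ x y : x + (y + 1) = x + y + 1.
Proof. exact (@rca_sat _ (two x y) ba_addS). Qed.

Lemma num_mul_0 x : x * 0 = 0.
Proof. exact (@rca_sat _ (two x x) ba_mul0). Qed.

Lemma num_mul_succ x y : x * (y + 1) = x * y + x.
Proof. exact (@rca_sat _ (two x y) ba_mulS). Qed.

Lemma num_lt_0 x : ~ x < 0.
Proof. exact (@rca_sat _ (two x x) ba_lt0). Qed.

Lemma num_lt_succ x y : x < y + 1 <-> x < y \/ x = y.
Proof.
  pose proof (@rca_sat _ (two x y) ba_ltS) as H. apply sat_Iff in H. simpl in H.
  cbv in H. tauto.
Qed.

Ltac num_induction x :=
  revert x;
  match goal with |- forall x, @?P x =>
    refine (delta0_induction HM P _ _ _); cbn beta; [definable| |]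
  end.

Lemma num_0_add x : 0 + x = x.
Proof.
  num_induction x; [apply num_add_0|].
  intros x E. now rewrite num_add_succ, E.
Qed.

Lemma num_add_assoc x y z : x + (y + z) = x + y + z.
Proof.
  num_induction z; [now rewrite !num_add_0|].
  intros z E. now rewrite !num_add_succ, E.
Qed.

Lemma num_1_add x : 1 + x = x + 1.
Proof.
  num_induction x; [now rewrite num_add_0, num_0_add|].
  intros x E. now rewrite num_add_succ, E.
Qed.

Lemma num_add_comm x y : x + y = y + x.
Proof.
  num_induction y; [now rewrite num_add_0, num_0_add|].
  intros y E. now rewrite num_add_succ, E, <- num_add_assoc, <- num_1_add, num_add_assoc.
Qed.

Lemma num_0_mul x : 0 * x = 0.
Proof.
  num_induction x; [apply num_mul_0|].
  intros x E. now rewrite num_mul_succ, E, num_add_0.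
Qed.

Lemma num_mul_add x y z : x * (y + z) = x * y + x * z.
Proof.
  num_induction z; [now rewrite num_mul_0, !num_add_0|].
  intros z E. now rewrite num_add_succ, !num_mul_succ, E, num_add_assoc.
Qed.

Lemma num_mul_assoc x y z : x * (y * z) = x * y * z.
Proof.
  num_induction z; [now rewrite !num_mul_0|].
  intros z E. now rewrite !num_mul_succ, num_mul_add, E.
Qed.

Lemma num_add_mul x y z : (x + y) * z = x * z + y * z.
Proof.
  num_induction z; [now rewrite !num_mul_0, num_add_0|].
  intros z E. rewrite !num_mul_succ, E, <- !num_add_assoc. f_equal.
  rewrite !num_add_assoc. f_equal. apply num_add_comm.
Qed.

Lemma num_1_mul x : 1 * x = x.
Proof.
  num_induction x; [apply num_mul_0|].
  intros x E. now rewrite num_mul_succ, E.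
Qed.

Lemma num_mul_comm x y : x * y = y * x.
Proof.
  num_induction y; [now rewrite num_mul_0, num_0_mul|].
  intros y E. now rewrite num_mul_succ, num_add_mul, E, num_1_mul.
Qed.

Lemma num_semi_ring : semi_ring_theory 0 1 (madd M) (mmul M) eq.
Proof.
  constructor; intros; [apply num_0_add|apply num_add_comm|apply num_add_assoc
    |apply num_1_mul|apply num_0_mul|apply num_mul_comm|apply num_mul_assoc
    |apply num_add_mul].
Qed.

Add Ring num_ring : num_semi_ring.

Lemma num_add_cancel x y z : x + z = y + z -> x = y.
Proof.
  num_induction z; [now rewrite !num_add_0|].
  intros z IH E. apply IH, succ_inj. now rewrite <- !num_add_succ.
Qed.

Lemma num_lt_add x z : x < x + z + 1.
Proof.
  num_induction z.
  - apply num_lt_succ. right. ring.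
  - intros z H. apply num_lt_succ. left. now rewrite num_add_assoc.
Qed.

Lemma num_lt_iff x y : x < y <-> exists z, y = x + z + 1.
Proof.
  split; [|intros [z ->]; apply num_lt_add].
  revert y. apply (sigma1_induction HM (fun y => x < y -> exists z, y = x + z + 1)).
  (* The existential is pulled in front of the implication; when the premise fails, 0 serves as
     witness. *)
  - exists (fun rho => x < rho 1%nat -> rho 1%nat = x + rho 0%nat + 1). split; [definable|].
    intros rho. simpl. split; [|firstorder].
    intros H. destruct (classic (x < rho 0%nat)) as [L|L].
    + destruct (H L) as [z Hz]. now exists z.
    + now exists 0.
  - intros H. now apply num_lt_0 in H.
  - intros y IH H. apply num_lt_succ in H as [H|<-].
    + destruct (IH H) as [z ->]. exists (z + 1). ring.
    + exists 0. ring.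
Qed.

Lemma num_add_ne x z : x <> x + z + 1.
Proof.
  intros E. apply (@succ_ne0 z). apply num_add_cancel with x.
  rewrite num_0_add at 1. rewrite E at 2. ring.
Qed.

Lemma num_lt_trans x y z : x < y -> y < z -> x < z.
Proof.
  rewrite !num_lt_iff. intros [u ->] [v ->]. exists (u + v + 1). ring.
Qed.

Lemma num_zero_or_succ x : x = 0 \/ exists y, x = y + 1.
Proof.
  revert x. apply (sigma1_induction HM (fun x => x = 0 \/ exists y, x = y + 1)).
  - exists (fun rho => rho 1%nat = 0 \/ rho 1%nat = rho 0%nat + 1). split; [definable|].
    intros rho. simpl. split.
    + intros [H|[y H]]; [exists 0|exists y]; auto.
    + intros [y [H|H]]; eauto.
  - now left.
  - intros x _. right. now exists x.
Qed.

Lemma num_total x y : x < y \/ x = y \/ y < x.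
Proof.
  num_induction y.
  - destruct (num_zero_or_succ x) as [->|[z ->]]; auto.
    right; right. apply num_lt_iff. exists z. ring.
  - intros y [H|[->|H]].
    + left. apply num_lt_succ. now left.
    + left. apply num_lt_succ. now right.
    + apply num_lt_iff in H as [z ->].
      destruct (num_zero_or_succ z) as [->|[u ->]].
      * right; left. ring.
      * right; right. apply num_lt_iff. exists u. ring.
Qed.

Lemma num_lt_or_add x y : x < y \/ exists z, x = y + z.
Proof.
  destruct (num_total x y) as [H|[->|H]]; auto; right.
  - exists 0. ring.
  - apply num_lt_iff in H as [z ->]. exists (z + 1). ring.
Qed.

Lemma num_not_lt x y : ~ x < y <-> exists z, x = y + z.
Proof.
  split.
  - intros H. now destruct (num_lt_or_add x y).
  - intros [z ->] H. apply num_lt_iff in H as [u E]. apply (@num_add_ne y (z + u)).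
    rewrite E at 1. ring.
Qed.

Lemma num_least (P : num M -> Prop) a :
  delta0 (fun rho => P (rho 0%nat)) -> P a ->
  exists b, P b /\ forall c, c < b -> ~ P c.
Proof.
  intros HP Pa. apply NNPP. intros N.
  assert (H : forall x c, c < x -> ~ P c).
  { intros x. num_induction x.
    - intros c Hc. now apply num_lt_0 in Hc.
    - intros x IH c Hc Pc. apply N. apply num_lt_succ in Hc as [Hc| ->].
      + now apply (IH c) in Pc.
      + now exists x. }
  apply (H (a + 1) a); trivial. apply num_lt_succ. now right.
Qed.



(** From here on, [x < y + 1] plays the part of a weak inequality. *)
Lemma num_lt_succ_iff x y : x < y + 1 <-> exists z, y = x + z.
Proof.
  rewrite num_lt_iff. split; intros [z E]; exists z.
  - now apply succ_inj.
  - now rewrite E.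
Qed.

Lemma num_le_trans x y z : x < y + 1 -> y < z + 1 -> x < z + 1.
Proof.
  rewrite !num_lt_succ_iff. intros [u ->] [v ->]. exists (u + v). ring.
Qed.

(** * The pairing function *)

Lemma pair_bound_l i j : i < Pair M i j + 1.
Proof. apply num_lt_succ_iff. exists ((i + j) * (i + j)). unfold Pair. ring. Qed.

Lemma num_le_square x : x < x * x + 1.
Proof.
  apply num_lt_succ_iff. destruct (num_zero_or_succ x) as [->|[y ->]].
  - exists 0. ring.
  - exists (y * (y + 1)). ring.
Qed.

Lemma pair_bound_r i j : j < Pair M i j + 1.
Proof.
  apply num_le_trans with (i + j); [apply num_lt_succ_iff; exists i; ring|].
  apply num_le_trans with (1 := num_le_square _).
  apply num_lt_succ_iff. now exists i.
Qed.

Lemma pair_inj_aux i j i' j' : i + j < i' + j' -> Pair M i j <> Pair M i' j'.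
Proof.
  intros H. apply num_lt_iff in H as [u H]. unfold Pair. rewrite H. set (s := i + j).
  (* The second argument is (s + u + 1)^2 + i' - (s^2 + i) - 1 expanded, with 2s - i written as s +
     j to avoid subtraction. *)
  intros E. apply (@num_add_ne (s * s + i)
    (j + s + (1 + 1) * (s * u) + u * u + (1 + 1) * u + i')).
  rewrite E at 1. unfold s. ring.
Qed.

Lemma pair_inj i j i' j' : Pair M i j = Pair M i' j' -> i = i' /\ j = j'.
Proof.
  intros E. destruct (num_total (i + j) (i' + j')) as [H|[H|H]].
  - now apply pair_inj_aux in H.
  - assert (i = i') as <-.
    { unfold Pair in E. rewrite H in E. apply num_add_cancel with ((i' + j') * (i' + j')).
      rewrite num_add_comm, E. apply num_add_comm. }
    split; trivial. apply num_add_cancel with i. now rewrite num_add_comm, H, num_add_comm.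
  - symmetry in E. now apply pair_inj_aux in H.
Qed.

(** Instead of substituting a term into a formula, the value is named by a bounded quantifier: some
    x at most [f rho] equals [f rho] and satisfies [P]. *)
Lemma delta0_apply1 (P : num M -> Prop) f :
  polynomial f -> delta0 (fun rho => P (rho 0%nat)) -> delta0 (fun rho => P (f rho)).
Proof.
  intros Hf HP.
  apply delta0_ext with (fun rho => exists x, x < f rho + 1 /\ (x = f rho /\ P x)).
  - intros rho. split.
    + intros H. exists (f rho). split; auto. apply num_lt_succ. now right.
    + now intros (x & _ & -> & H).
  - apply (delta0_ex_lt A0) with (P := fun rho x => x = f rho /\ P x); [definable|].
    definable. now apply polynomial_shift.
Qed.

Lemma delta0_apply2 (P : num M -> num M -> Prop) f g :
  polynomial f -> polynomial g -> delta0 (fun rho => P (rho 0%nat) (rho 1%nat)) ->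
  delta0 (fun rho => P (f rho) (g rho)).
Proof.
  intros Hf Hg HP.
  apply delta0_ext with (fun rho => exists y, y < g rho + 1 /\
    ((fun rho y => exists x, x < f rho + 1 /\
       ((fun rho x => x = f rho /\ y = g rho /\ P x y) rho x)) rho y)).
  - intros rho. split.
    + intros H. exists (g rho). split; [apply num_lt_succ; now right|].
      exists (f rho). split; [apply num_lt_succ; now right|auto].
    + intros (y & _ & x & _ & -> & -> & H). exact H.
  - apply (delta0_ex_lt A0); [definable|].
    apply (delta0_ex_lt A0) with
      (f := fun rho => (f (fun n : nat => rho (S n)) + 1)%num)
      (P := fun rho x => x = f (fun n : nat => rho (S n)) /\
                         rho 0%nat = g (fun n : nat => rho (S n)) /\ P x (rho 0%nat)).
    + apply polynomial_add; [now apply polynomial_shift|polynomial].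
    + definable;
      first [apply (polynomial_shift (f := fun rho => f (fun n : nat => rho (S n))))
            |apply (polynomial_shift (f := fun rho => g (fun n : nat => rho (S n))))];
      now apply polynomial_shift.
Qed.

(** * Finite sets and their codes *)

Lemma In_fin_bounded i z :
  In_fin M i z <-> exists k, k < z + 1 /\ exists m, m < z + 1 /\ exists n, n < z + 1 /\
    (z = Pair M k (Pair M m n) /\ i < k /\
     exists q, q < n + 1 /\ n = q * (m * (i + 1) + 1)).
Proof.
  split.
  - intros (k & m & n & -> & Hi & q & Hq).
    assert (B := pair_bound_r k (Pair M m n)).
    exists k. split; [apply pair_bound_l|].
    exists m. split; [apply num_le_trans with (1 := pair_bound_l m n), B|].
    exists n. split; [apply num_le_trans with (1 := pair_bound_r m n), B|].
    repeat split; trivial. exists q. split; trivial.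
    (* The modulus is at least 1, so the quotient is at most n. *)
    apply num_lt_succ_iff. exists (q * (m * (i + 1))). rewrite Hq. ring.
  - intros (k & _ & m & _ & n & _ & E & Hi & q & _ & Hq).
    exists k, m, n. repeat split; trivial. now exists q.
Qed.

Lemma In_fin_le i z : In_fin M i z -> i < z.
Proof.
  intros (k & m & n & -> & Hi & _).
  destruct (proj1 (num_lt_succ _ _) (pair_bound_l k (Pair M m n))) as [H|<-]; trivial.
  now apply num_lt_trans with k.
Qed.

Lemma delta0_In_fin f g :
  polynomial f -> polynomial g -> delta0 (fun rho => In_fin M (f rho) (g rho)).
Proof.
  intros Hf Hg. apply (delta0_apply2 (In_fin M) Hf Hg).
  eapply delta0_ext; [intros rho; apply In_fin_bounded|]. unfold Pair. definable.
Qed.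

Lemma delta0_Is_triple f : polynomial f -> delta0 (fun rho => Is_triple M (f rho)).
Proof.
  intros Hf. apply (delta0_apply1 (Is_triple M) Hf).
  apply delta0_ext with (fun rho => exists k, k < rho 0%nat + 1 /\
    exists m, m < rho 0%nat + 1 /\ exists n, n < rho 0%nat + 1 /\
    rho 0%nat = Pair M k (Pair M m n)); [|unfold Pair; definable].
  intros rho. split.
  - intros (k & m & n & ->).
    assert (B := pair_bound_r k (Pair M m n)).
    exists k. split; [apply pair_bound_l|].
    exists m. split; [apply num_le_trans with (1 := pair_bound_l m n), B|].
    exists n. split; [apply num_le_trans with (1 := pair_bound_r m n), B|]. easy.
  - intros (k & _ & m & _ & n & _ & E). now exists k, m, n.
Qed.

Lemma delta0_Is_code f : polynomial f -> delta0 (fun rho => Is_code M (f rho)).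
Proof.
  intros Hf. apply (delta0_apply1 (Is_code M) Hf).
  (* Elements lie below their code and [w] is below [rho 0], so comparing the two sets below [rho 0]
     suffices. *)
  apply delta0_ext with (fun rho => Is_triple M (rho 0%nat) /\
    forall w, w < rho 0%nat -> Is_triple M w ->
    ~ forall i, i < rho 0%nat -> (In_fin M i w <-> In_fin M i (rho 0%nat))).
  - intros rho. split; intros [H1 H2]; split; trivial.
    + intros w Hw Tw H. apply (H2 w); [easy|]. intros i.
      destruct (classic (i < rho 0%nat)) as [L|L]; [auto|].
      split; intros I; exfalso; apply L; apply In_fin_le in I; trivial.
      now apply num_lt_trans with w.
    + intros w [Hw Tw] H. apply (H2 w); auto.
  - repeat first [simple apply delta0_Is_triple | simple apply delta0_In_fin | definable].
Qed.

Ltac definable_hook ::=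
  first [ simple apply delta0_In_fin | simple apply delta0_Is_triple
        | simple apply delta0_Is_code ].

(** Take the least triple with the same elements. Elements of [w] and [z] lie below [w + z], so this
    bound makes the comparison [delta0] and [num_least] applicable. *)
Lemma exists_code z :
  Is_triple M z -> exists c, Is_code M c /\ forall i, In_fin M i c <-> In_fin M i z.
Proof.
  intros Tz.
  destruct (@num_least (fun w => Is_triple M w /\
    forall i, i < w + z -> (In_fin M i w <-> In_fin M i z)) z)
    as (c & [Tc Hc] & L); [definable|now split|].
  assert (E : forall i, In_fin M i c <-> In_fin M i z).
  { intros i. destruct (classic (i < c + z)) as [B|B]; [auto|].
    apply num_not_lt in B as [u ->].
    split; intros I; apply In_fin_le in I; exfalso; revert I; apply num_not_lt;
      [exists (z + u)|exists (c + u)]; ring. }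
  exists c. repeat split; try apply E; trivial.
  intros w [Hw Tw] H. apply (L w); trivial. split; trivial.
  intros i _. now rewrite H.
Qed.

Lemma code_unique a b :
  Is_code M a -> Is_code M b -> (forall i, In_fin M i a <-> In_fin M i b) -> a = b.
Proof.
  intros [Ta Ha] [Tb Hb] E. destruct (num_total a b) as [H|[H|H]]; trivial; exfalso.
  - now apply (Hb a).
  - apply (Ha b); [easy|]. intros i. now rewrite E.
Qed.

(** With a = y + 1, use the triple (a, (a, a^2 + 1)): its modulus at i is a(i + 1) + 1, which for i
    = y is a^2 + 1 itself. If i < y and q times the modulus is a^2 + 1, then q is not 0 or 1, while
    q is 1 modulo a; so q exceeds a and the product is too large. *)
Lemma exists_singleton y : exists c, Is_code M c /\ forall i, In_fin M i c <-> i = y.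
Proof.
  set (a := y + 1).
  destruct (@exists_code (Pair M a (Pair M a (a * a + 1)))) as (c & Hc & E).
  { now exists a, a, (a * a + 1). }
  exists c. split; trivial. intros i. rewrite E. split.
  - intros (k & m & n & EP & Hi & q & Hq).
    apply pair_inj in EP as [<- EP]. apply pair_inj in EP as [<- <-].
    apply num_lt_succ in Hi as [Hi| ->]; trivial. exfalso.
    destruct (num_zero_or_succ q) as [->|[r ->]].
    { rewrite num_0_mul in Hq. now apply succ_ne0 in Hq. }
    destruct (num_zero_or_succ r) as [->|[t ->]].
    { apply num_lt_iff in Hi as [u Hu]. rewrite num_0_add, num_1_mul in Hq.
      apply succ_inj in Hq. apply (@num_add_ne (a * (i + 1)) (a * u + y)).
      transitivity (a * (y + 1)); [now symmetry|]. rewrite Hu at 1. unfold a. ring. }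
    (* [q = t + 2] and [a * a = a * b + (t + 1)], where [b = (t + 2) * (i + 1)]. *)
    set (b := (t + 1 + 1) * (i + 1)).
    assert (Hq' : a * a = a * b + t + 1).
    { apply succ_inj. rewrite Hq. unfold b. ring. }
    destruct (num_lt_or_add b a) as [Hb|[u Hu]].
    + apply num_lt_iff in Hb as [u Hu].
      assert (E1 : a * (u + 1) = t + 1).
      { apply num_add_cancel with (a * b). transitivity (a * (b + u + 1)); [ring|].
        rewrite <- Hu, Hq'. ring. }
      apply (@num_add_ne (t + 1) ((t + 1 + 1) * i + u + 1 + a * u)).
      transitivity (a * (u + 1)); [now symmetry|].
      transitivity (a * u + (b + u + 1)); [rewrite <- Hu; ring|]. unfold b. ring.
    + apply (@num_add_ne (a * a) (a * u + t)).
      transitivity (a * b + t + 1); [exact Hq'|]. rewrite Hu. ring.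
  - intros ->. exists a, a, (a * a + 1). split; [easy|]. split.
    + apply num_lt_succ. now right.
    + exists 1. unfold a. ring.
Qed.


(** * From arithmetical comprehension to an isomorphic matroid *)

Lemma range_exists e :
  models M ACA0 -> exists D, forall c, mem M c D <-> In_range M e c.
Proof.
  intros HA.
  (* This is membership of [Pair n c] in [e] with the pairing unfolded: [Var 0] is the bound n and
     [Var 1] is c. *)
  set (p := ExN (Mem (Add (Mul (Add (Var 0) (Var 1)) (Add (Var 0) (Var 1))) (Var 0)) 0)).
  assert (Hp : arithmetical p) by (simpl; tauto).
  assert (C := HA _ (aca_comprehension p Hp) (fun _ => 0) (fun _ => e)).
  apply sat_ExS in C as [D HD]. exists D. intros c. specialize (HD c).
  rewrite sat_Iff, sat_shiftS in HD. unfold p in HD. rewrite sat_ExN in HD. exact HD.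
Qed.

Lemma ematroid_isomorphic_to_matroid :
  models M ACA0 -> Every_ematroid_isomorphic_to_matroid M.
Proof.
  intros HA G e ((HF1 & HF2 & HF3) & Hne & Hup & Hex).
  destruct (range_exists e HA) as [D HD].
  destruct (@delta0_comprehension M A0 HM
    (fun p => exists x, x < p + 1 /\ (mem M x G /\ p = Pair M x x))) as [h Hh].
  { unfold Pair. definable. }
  assert (Hh' : forall x y, mem M (Pair M x y) h <-> mem M x G /\ x = y).
  { intros x y. rewrite Hh. split.
    - intros (z & _ & Hz & E). now apply pair_inj in E as [-> ->].
    - intros [Hx <-]. exists x. split; [apply pair_bound_l|easy]. }
  assert (HDG : forall c, mem M c D -> Fin_subset_of M G c).
  { intros c Hc. apply HD in Hc as [n Hn].
    apply HF1 in Hn as (x & y & _ & Hy & E). now apply pair_inj in E as [_ ->]. }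
  exists G, D, h. split.
  - split; [exact HDG|split; [|split]].
    + intros c Hc. apply HD in Hc as [n Hn]. eauto.
    + intros c b (Hc & Hb). apply HD in Hc as [n Hn]. apply HD. eauto.
    + intros a b (Ha & Hb & Hab & Na & Nb). rewrite HD in Na, Nb.
      destruct (Hex a b) as (y & Hy & N); [easy|]. exists y. split; trivial.
      intros (c & Hc & E & Dc). apply N. exists c. now rewrite <- HD.
  - split; [split; [split; [|split]|split]|].
    + intros p Hp. apply Hh in Hp as (x & _ & Hx & ->). now exists x, x.
    + intros x Hx. exists x. now apply Hh'.
    + intros x y z [H1 H2]. apply Hh' in H1 as [_ <-]. now apply Hh' in H2 as [_ <-].
    + intros x y z [H1 H2]. apply Hh' in H1 as [_ ->]. now apply Hh' in H2 as [_ ->].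
    + intros y Hy. exists y. now apply Hh'.
    + intros a [Ca Ha]. split.
      * intros R. exists a. split; trivial. split; [|now apply HD].
        intros y. split.
        -- intros Hy. exists y. split; trivial. apply Hh'. auto.
        -- intros (x & Hx & Hxy). now apply Hh' in Hxy as [_ <-].
      * intros (c & Hc & E & Dc). apply HD in Dc.
        assert (a = c) as ->; trivial. apply code_unique; trivial.
        intros i. rewrite E. split.
        -- intros Hi. exists i. split; trivial. apply Hh'. auto.
        -- intros (x & Hx & Hxi). now apply Hh' in Hxi as [_ <-].
Qed.

(** * The reversal: projections from isomorphisms *)

Lemma loop_ematroid Y x0 w0 :
  mem M (Pair M x0 w0) Y ->
  exists G e, Is_ematroid M G e /\ (forall x, mem M x G) /\
    forall c, In_range M e c <->
      Is_code M c /\ exists w, In_fin M w c /\ exists x, mem M (Pair M x w) Y.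
Proof.
  intros H0. destruct (exists_singleton w0) as (c0 & Hc0 & E0).
  destruct (@delta0_comprehension M A0 HM (fun x => x = x)) as [G HG]; [definable|].
  (* The stage [s] bounds the witness [x], which makes [meets] a [delta0] relation although meeting
     R is only Sigma^0_1. *)
  set (meets a s := Is_code M a /\ exists w, w < a /\
    (In_fin M w a /\ exists x, x < s /\ mem M (Pair M x w) Y)).
  (* At n = (c, s) the value is c if c is seen to meet R by stage s. Every other n gets [c0], the
     code of {w0}, which is dependent by the hypothesis on [x0] and [w0]; this keeps [e] total. *)
  set (graph n c :=
    (exists s, s < n + 1 /\ (n = Pair M c s /\ meets c s)) \/
    (~ (exists a, a < n + 1 /\ exists s, s < n + 1 /\ (n = Pair M a s /\ meets a s))
     /\ c = c0)).
  destruct (@delta0_comprehension M A0 HM (fun p => exists n, n < p + 1 /\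
    exists c, c < p + 1 /\ (p = Pair M n c /\ graph n c))) as [e He].
  { unfold graph, meets, Pair. definable. }
  assert (He' : forall n c, mem M (Pair M n c) e <-> graph n c).
  { intros n c. rewrite He. split.
    - intros (n' & _ & c' & _ & E & H). now apply pair_inj in E as [-> ->].
    - intros H. exists n. split; [apply pair_bound_l|].
      exists c. split; [apply pair_bound_r|easy]. }
  assert (Hr : forall c, In_range M e c <->
    Is_code M c /\ exists w, In_fin M w c /\ exists x, mem M (Pair M x w) Y).
  { intros c. split.
    - intros [n Hn]. apply He' in Hn as [(s & _ & _ & Hc & w & _ & Hw & x & _ & Hx)|[_ ->]].
      + split; trivial. exists w. split; trivial. now exists x.
      + split; trivial. exists w0. split; [now apply E0|now exists x0].
    - intros (Hc & w & Hw & x & Hx). exists (Pair M c (x + 1)). apply He'. left.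
      exists (x + 1). split; [apply pair_bound_r|]. split; trivial. split; trivial.
      exists w. split; [now apply In_fin_le|]. split; trivial.
      exists x. split; trivial. apply num_lt_succ. now right. }
  exists G, e. split; [|split; [intros x; now apply HG|exact Hr]].
  split; [split; [|split]|split; [|split]].
  - intros p Hp. apply He in Hp as (n & _ & c & _ & E & H). exists n, c.
    split; trivial. split; trivial. split; [|intros; now apply HG].
    apply Hr. exists n. now apply He'.
  - intros n _.
    destruct (classic (exists a, a < n + 1 /\ exists s, s < n + 1 /\
      (n = Pair M a s /\ meets a s))) as [H|H].
    + destruct H as (a & Ha & s & Hs & E & H). exists a. apply He'. left. now exists s.
    + exists c0. apply He'. now right.
  - intros n c c' [H H']. apply He' in H, H'.
    destruct H as [(s & Ls & E & H)|[H ->]], H' as [(s' & Ls' & E' & H')|[H' ->]]; trivial.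
    + rewrite E in E'. now apply pair_inj in E'.
    + exfalso. apply H'. exists c. split; [rewrite E; apply pair_bound_l|]. now exists s.
    + exfalso. apply H. exists c'. split; [rewrite E'; apply pair_bound_l|]. now exists s'.
  - intros n c H. assert (R : In_range M e c) by now exists n.
    apply Hr in R as (_ & w & Hw & _). now exists w.
  - intros n c b (H & [Hb _] & Hcb). assert (R : In_range M e c) by now exists n.
    apply Hr in R as (_ & w & Hw & Hx). apply Hr. split; trivial. exists w. auto.
  - intros a b ([Ca _] & [Cb _] & (k & l & _ & (f & Cf & Hf) & Hkl) & Na & Nb).
    assert (exists y, In_fin M y b) as [y Hy].
    { destruct Hf as ((H1 & H2 & _) & _ & _).
      destruct (H2 k Hkl) as [y Hy]. exists y.
      destruct (H1 _ Hy) as (x & y' & _ & Hy' & E). now apply pair_inj in E as [_ ->]. }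
    exists y. split; trivial. intros (c & Cc & E & R).
    apply Hr in R as (_ & w & Hw & Hx). apply E in Hw as [Hw| ->].
    + apply Na, Hr. split; trivial. now exists w.
    + apply Nb, Hr. split; trivial. now exists y.
Qed.

Hypothesis HE : Every_ematroid_isomorphic_to_matroid M.

Lemma projection_exists Y :
  exists X, forall w, mem M w X <-> exists x, mem M (Pair M x w) Y.
Proof.
  (* If the projection is empty, no finite set meets it and [e] would have no possible value; the
     empty set is then the answer. *)
  destruct (classic (exists x w, mem M (Pair M x w) Y)) as [(x0 & w0 & H0)|N].
  2:{ destruct (@delta0_comprehension M A0 HM (fun x => False)) as [X HX]; [definable|].
      exists X. intros w. rewrite HX. split; [easy|]. intros [x Hx]. apply N. eauto. }
  destruct (loop_ematroid _ _ _ H0) as (G & e & Hm & HG & Hr).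
  destruct (HE Hm) as (N & D & h & HN & ((F1 & F2 & F3) & _ & _) & HI).
  (* The isomorphism is used on singletons only: {h(w)} is dependent iff {w} is, that is, iff w lies
     in the projection. *)
  assert (HP : forall w y c, mem M (Pair M w y) h -> Is_code M c ->
    (forall i, In_fin M i c <-> i = y) ->
    (mem M c D <-> exists x, mem M (Pair M x w) Y)).
  { intros w y c Hwy Cc Ec. destruct (exists_singleton w) as (a & Ca & Ea).
    assert (Im : forall z, z = y <-> exists x, In_fin M x a /\ mem M (Pair M x z) h).
    { intros z. split.
      - intros ->. exists w. split; trivial. now apply Ea.
      - intros (x & Hx & Hxz). apply Ea in Hx as ->. now apply (F3 w). }
    transitivity (In_range M e a).
    - rewrite HI by (split; trivial). split.
      + intros Dc. exists c. split; trivial. split; trivial.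
        intros z. now rewrite Ec.
      + intros (c' & Cc' & Ec' & Dc'). assert (c = c') as ->; trivial.
        apply code_unique; trivial. intros i. now rewrite Ec, Ec'.
    - rewrite Hr. split.
      + intros (_ & w' & Hw' & Hx). now apply Ea in Hw' as ->.
      + intros Hx. split; trivial. exists w. split; trivial. now apply Ea. }
  apply (@delta1_comprehension M HM (fun w => exists x, mem M (Pair M x w) Y)).
  - exists (fun rho => mem M (Pair M (rho 0%nat) (rho 1%nat)) Y).
    split; [unfold Pair; definable|easy].
  (* The single witness bounds both y = h(w) and the code c of {y}. Beyond c + y neither side of the
     inner equivalence can hold, so that bound loses nothing. *)
  - exists (fun rho => exists y, y < rho 0%nat + 1 /\ exists c, c < rho 0%nat + 1 /\
      (mem M (Pair M (rho 1%nat) y) h /\ Is_code M c /\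
       (forall i, i < c + y + 1 -> (In_fin M i c <-> i = y)) /\ ~ mem M c D)).
    split; [unfold Pair; definable|]. intros rho. simpl. set (w := rho 0%nat). split.
    + intros Nw. destruct (F2 w (HG w)) as [y Hy].
      destruct (exists_singleton y) as (c & Cc & Ec).
      exists (Pair M y c), y. split; [apply pair_bound_l|].
      exists c. split; [apply pair_bound_r|].
      split; [exact Hy|split; [exact Cc|split; [intros; apply Ec|]]].
      intros Dc. now apply (HP w y c) in Dc.
    + intros (p & y & _ & c & _ & Hy & Cc & Ec & Nc) Hw.
      apply Nc, (HP w y c); trivial. intros i.
      destruct (classic (i < c + y + 1)) as [L|L]; [auto|].
      apply num_not_lt in L as [u ->]. split; intros I; exfalso.
      * apply In_fin_le in I. revert I. apply num_not_lt. exists (y + 1 + u). ring.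
      * apply (@num_add_ne y (c + u)). rewrite <- I at 1. ring.
Qed.

(** * From projections to arithmetical comprehension *)

Lemma sigma1_ex (P : (nat -> num M) -> Prop) :
  sigma1 P -> sigma1 (fun rho => exists x, P (scons x rho)).
Proof.
  intros (Q & HQ & E).
  (* [g] skips index 2, where the common bound on the two witnesses sits. *)
  set (g := scons (inl 0%nat) (scons (inl 1%nat) (fun n : nat => inl (S (S (S n)))))
       : nat -> nat + num M).
  assert (Eg : forall rho,
    valuation g rho = scons (rho 0%nat) (scons (rho 1%nat) (fun n : nat => rho (S (S (S n)))))).
  { intros rho. now apply functional_extensionality; intros [|[|n]]. }
  exists (fun rho => exists x, x < rho 0%nat + 1 /\ exists y, y < rho 0%nat + 1 /\
    Q (scons y (scons x (fun n : nat => rho (S n))))).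
  split.
  - apply (delta0_ex_lt A0) with (P := fun rho x => exists y, y < rho 0%nat + 1 /\
      Q (scons y (scons x (fun n : nat => rho (S n))))); [definable|].
    apply (delta0_ex_lt A0) with (P := fun rho y =>
      Q (scons y (scons (rho 0%nat) (fun n : nat => rho (S (S n)))))); [definable|].
    apply delta0_ext with (2 := delta0_valuation g HQ). intros rho. now rewrite Eg.
  - intros rho. split.
    (* The pair serves as a number that bounds both [x] and [y]; it is never decoded. *)
    + intros [x Hx]. apply E in Hx as [y Hy]. exists (Pair M x y), x.
      split; [apply pair_bound_l|]. exists y. split; [apply pair_bound_r|exact Hy].
    + intros (z & x & _ & y & _ & H). exists x. apply E. now exists y.
Qed.

Lemma sigma1_comprehension (P : num M -> Prop) :
  sigma1 (fun rho => P (rho 0%nat)) -> exists X, forall w, mem M w X <-> P w.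
Proof.
  intros (Q & HQ & E).
  apply delta0_first_two in HQ.
  destruct (@delta0_comprehension M A0 HM (fun p => exists w, w < p + 1 /\
    exists x, x < p + 1 /\ (p = Pair M x w /\ Q (first_two w x)))) as [Y HY].
  { unfold Pair. definable. }
  destruct (projection_exists Y) as [X HX]. exists X. intros w.
  rewrite HX, (E (scons w (fun _ => 0))). split; intros [x Hx]; exists x.
  - apply HY in Hx as (w' & _ & x' & _ & Ep & H). now apply pair_inj in Ep as [-> ->].
  - apply HY. exists w. split; [apply pair_bound_r|].
    exists x. split; [apply pair_bound_l|now split].
Qed.

(** A variable bound by a quantifier enters at index 0 and becomes the first coordinate of the
    outermost pair, exactly the coordinate that [projection_exists] removes. *)
Fixpoint tuple (d : nat) (rho : nat -> num M) : num M :=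
  match d with
  | O => 0
  | S d => Pair M (rho O) (tuple d (fun n : nat => rho (S n)))
  end.

Definition prepend (d : nat) (rho rho' : nat -> num M) (n : nat) : num M :=
  if Nat.ltb n d then rho n else rho' (Nat.sub n d).

Lemma tuple_ext d : forall rho rho',
  tuple d rho = tuple d rho' <-> forall n : nat, (n < d)%nat -> rho n = rho' n.
Proof.
  induction d as [|d IH]; intros rho rho'; simpl; [split; [lia|easy]|].
  split.
  - intros E. apply pair_inj in E as [E0 E]. intros [|n] Hn; trivial.
    apply (proj1 (IH _ _) E). lia.
  - intros H. f_equal; [apply H; lia|]. apply IH. intros n Hn. apply H. lia.
Qed.

Lemma polynomial_tuple d : polynomial (tuple d).
Proof.
  induction d as [|d IH]; [apply polynomial_const|].
  apply polynomial_shift in IH. cbn [tuple]. unfold Pair. polynomial; trivial.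
Qed.

Lemma prepend_lt d rho rho' n : (n < d)%nat -> prepend d rho rho' n = rho n.
Proof. intros H. unfold prepend. now apply Nat.ltb_lt in H as ->. Qed.

Lemma prepend_ge d rho rho' n : prepend d rho rho' (d + n)%nat = rho' n.
Proof.
  unfold prepend. destruct (Nat.ltb_spec (d + n) d); [lia|]. f_equal. lia.
Qed.

Lemma prepend_at d rho rho' : prepend d rho rho' d = rho' O.
Proof. rewrite <- (prepend_ge d rho rho' O). now rewrite Nat.add_0_r. Qed.

Lemma prepend_eq d rho rho' sg :
  (forall n : nat, (n < d)%nat -> sg n = rho n) ->
  (forall n : nat, sg (d + n)%nat = rho' n) -> prepend d rho rho' = sg.
Proof.
  intros H1 H2. apply functional_extensionality; intros n. unfold prepend.
  destruct (Nat.ltb_spec n d); [now rewrite H1|]. rewrite <- H2. f_equal. lia.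
Qed.

(** Only the first [d] entries of [rho] are read, so the quantifier over environments amounts to [d]
    number quantifiers. Each step of the induction peels off the last of these entries and moves it
    to the front of [rho']. *)
Lemma sigma1_ex_prepend d : forall P,
  sigma1 P -> sigma1 (fun rho' => exists rho, P (prepend d rho rho')).
Proof.
  induction d as [|d IH]; intros P HP.
  - apply sigma1_ext with (2 := HP). intros rho'.
    assert (E : forall rho, prepend 0 rho rho' = rho') by (intros; apply prepend_eq; easy || lia).
    split; [intros [rho H]|intros H; exists rho']; now rewrite E in *.
  - apply sigma1_ext with (2 := sigma1_ex (IH P HP)). intros rho'. split.
    + intros [rho H]. exists (rho d), rho.
      replace (prepend d rho _) with (prepend (S d) rho rho'); trivial.
      apply prepend_eq.
      * intros n Hn. destruct (Nat.eq_dec n d) as [->|Hd].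
        -- apply prepend_at.
        -- apply prepend_lt. lia.
      * intros n. replace (S d + n)%nat with (d + S n)%nat by lia.
        now rewrite prepend_ge.
    + intros (x & rho & H). exists (prepend d rho (fun _ => x)).
      replace (prepend (S d) _ rho') with (prepend d rho (scons x rho')); trivial.
      symmetry. apply prepend_eq.
      * intros n Hn. unfold prepend. destruct (Nat.ltb_spec n d); trivial.
        now replace (n - d)%nat with O by lia.
      * intros n. replace (S d + n)%nat with (d + S n)%nat by lia.
        now rewrite prepend_ge.
Qed.

(** The members are the w with w = [tuple d rho] for some [rho] that satisfies [q]. This is
    Sigma^0_1, and injectivity of tuples makes the choice of [rho] harmless. *)
Lemma tuple_comprehension d rho0 eta q :
  bounded_form q ->
  exists Y, forall rho, mem M (tuple d rho) Y <-> sat M (prepend d rho rho0) eta q.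
Proof.
  intros Bq.
  assert (HQ : delta0 (fun rho => sat M (prepend d rho rho0) eta q)).
  { exists q, (fun n => if Nat.ltb n d then inl n else inr (rho0 (Nat.sub n d))), eta.
    split; trivial. intros rho. replace (valuation _ rho) with (prepend d rho rho0); [easy|].
    apply functional_extensionality; intros n. unfold prepend, valuation.
    now destruct (Nat.ltb n d). }
  destruct (sigma1_comprehension (fun w => exists rho, w = tuple d rho /\
    sat M (prepend d rho rho0) eta q)) as [Y HY].
  (* Once [rho] is prepended, the candidate w, which is [rho' 0], sits at index [d]. *)
  - apply sigma1_ext with (2 := sigma1_ex_prepend d
      (sigma1_delta0 (delta0_and A0 (delta0_eq A0 (polynomial_var M d) (polynomial_tuple d)) HQ))).
    intros rho'.
    assert (E : forall rho, rho' O = tuple d rho /\ sat M (prepend d rho rho0) eta q <->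
      prepend d rho rho' d = tuple d (prepend d rho rho') /\
      sat M (prepend d (prepend d rho rho') rho0) eta q).
    { intros rho.
      replace (tuple d (prepend d rho rho')) with (tuple d rho)
        by (apply tuple_ext; intros; now rewrite prepend_lt).
      replace (prepend d (prepend d rho rho') rho0) with (prepend d rho rho0).
      - now rewrite prepend_at.
      - apply prepend_eq; intros n; [intros Hn|].
        + now rewrite !prepend_lt.
        + apply prepend_ge. }
    split; intros [rho H]; exists rho; now apply E.
  - exists Y. intros rho. rewrite HY. split; [|intros H; now exists rho].
    intros (rho' & E & H).
    replace (prepend d rho rho0) with (prepend d rho' rho0); trivial.
    apply prepend_eq; intros n; [intros Hn|apply prepend_ge].
    rewrite prepend_lt; trivial. now apply (proj1 (tuple_ext d rho rho') E).
Qed.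

Lemma arithmetical_comprehension p : arithmetical p ->
  forall d rho0 eta,
    exists Y, forall rho, mem M (tuple d rho) Y <-> sat M (prepend d rho rho0) eta p.
Proof.
  induction p; intros Hp d rho0 eta; try now apply tuple_comprehension; constructor.
  - destruct Hp as [Hp1 Hp2].
    destruct (IHp1 Hp1 d rho0 eta) as [Y1 H1], (IHp2 Hp2 d rho0 eta) as [Y2 H2].
    destruct (@delta0_comprehension M A0 HM (fun w => mem M w Y1 -> mem M w Y2))
      as [Y HY]; [definable|].
    exists Y. intros rho. now rewrite HY, H1, H2.
  (* A universal quantifier is the complement of the projection of a complement. The complements
     also contain numbers that are not tuples, but the claim concerns values of [tuple d] only. *)
  - destruct (IHp Hp (S d) rho0 eta) as [Y HY].
    destruct (@delta0_comprehension M A0 HM (fun w => ~ mem M w Y)) as [Y' HY'];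
      [definable|].
    destruct (projection_exists Y') as [X HX].
    destruct (@delta0_comprehension M A0 HM (fun w => ~ mem M w X)) as [X' HX'];
      [definable|].
    exists X'. intros rho. rewrite HX', HX. simpl.
    assert (E : forall x, mem M (Pair M x (tuple d rho)) Y
                          <-> sat M (scons x (prepend d rho rho0)) eta p).
    { intros x. rewrite (HY (scons x rho)).
      replace (prepend (S d) _ rho0) with (scons x (prepend d rho rho0)); [easy|].
      symmetry. apply prepend_eq.
      - intros [|n] Hn; trivial. simpl. apply prepend_lt. lia.
      - intros n. apply prepend_ge. }
    setoid_rewrite HY'. split.
    + intros N x. apply E, NNPP. eauto.
    + intros H [x Hx]. now apply Hx, E.
  - easy.
Qed.

Lemma models_ACA0 : models M ACA0.
Proof.
  intros p Hp rho eta. destruct Hp as [p Hp| |p Hp].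
  - now apply HM, rca_basic.
  - unfold induction_for. intros H. apply sat_And in H as [H0 HS].
    intros x. revert x. apply (delta0_induction HM (fun x => mem M x (eta O)));
      [definable|exact H0|exact HS].
  (* With d = 1 only the comprehension variable varies and all others are parameters. The tuple of x
     alone is [Pair M x 0]. *)
  - apply sat_ExS. destruct (arithmetical_comprehension p Hp 1%nat rho eta) as [Y HY].
    destruct (@delta0_comprehension M A0 HM (fun x => mem M (Pair M x 0) Y)) as [X HX];
      [unfold Pair; definable|].
    exists X. intros x. rewrite sat_Iff, sat_shiftS. cbn [sat eval scons].
    rewrite HX, (HY (fun _ => x)).
    replace (prepend 1%nat _ rho) with (scons x rho); [easy|].
    symmetry. apply prepend_eq; [intros [|n] Hn; trivial; lia|easy].
Qed.

End Arithmetic.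

Theorem theorem2p2 :
  equivalent_over RCA0 ACA0
    (fun p => p = sentence every_ematroid_isomorphic_to_matroid).
Proof.
  split.
  - intros p ->. apply completeness. intros M HM rho eta. apply sat_sentence.
    (* [eta 0] is the set of the model that the section variable [A0] asks for. *)
    apply ematroid_isomorphic_to_matroid; [exact (eta 0)| |];
      intros q Hq; apply HM; [now left|now right].
  - intros p Hp. apply completeness. intros M HM rho eta.
    apply models_ACA0; trivial; [exact (eta 0)| |].
    + intros q Hq. apply HM. now left.
    + apply (sat_sentence M rho eta), HM. now right.
Qed.
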